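(* Consider the dynamic panel data model $y=\Pi\gamma+\varepsilon$ with $\gamma=(\alpha',\eta')'$, $\alpha\in\mathbb{R}^p$ having $s_1\ge 1$ non-zero entries and $\sum_{i=1}^N|\eta_i|^\nu\le E$ ($0<\nu<1$, $E>0$), and let Assumptions 1, 2 and 3 of the context hold. Let $\lambda_N=\sqrt{4MNT(\log(p\vee N))^3}$ for some $M>0$, let $\hat\gamma=(\hat\alpha',\hat\eta')'$ be the panel Lasso estimator with this $\lambda_N$, and suppose that $s_1+E\left(\frac{\lambda_N}{\sqrt N T}\right)^{-\nu}\lesssim\sqrt N$. Then there are positive constants $A$ and $B$ such that, with probability at least $$1-Ap^{1-BM^{1/3}}-AN^{1-BM^{1/3}}-A(p^2+pN)\exp\left(-B\left\{N\Big/\left[s_1+E\left(\tfrac{\lambda_N}{\sqrt N T}\right)^{-\nu}\right]^2\right\}^{1/3}\right),$$ the following three inequalities hold: $$\frac{1}{NT}\|\Pi(\hat\gamma-\gamma)\|^2\le\frac{120\lambda_N^2s_1}{\kappa_2^2(NT)^2}+\left(\frac{120}{\kappa_2^2}+20\right)\frac{\lambda_N}{\sqrt N\,NT}E\left(\frac{\lambda_N}{\sqrt N T}\right)^{1-\nu},$$ $$\|\hat\alpha-\alpha\|_1\le\frac{120\lambda_Ns_1}{\kappa_2^2NT}+\left(\frac{120}{\kappa_2^2}+20\right)\frac{1}{\sqrt N}E\left(\frac{\lambda_N}{\sqrt N T}\right)^{1-\nu},$$ $$\|\hat\eta-\eta\|_1\le\frac{120\lambda_Ns_1}{\kappa_2^2\sqrt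 N T}+\left(\frac{120}{\kappa_2^2}+20\right)E\left(\frac{\lambda_N}{\sqrt N T}\right)^{1-\nu}.$$ Moreover, these bounds are valid uniformly over $\mathcal F(s_1,\nu,E):=\{\alpha\in\mathbb{R}^p:\|\alpha\|_0\le s_1\}\times\{\eta\in\mathbb{R}^N:\sum_{i=1}^N|\eta_i|^\nu\le E\}$.
   Context: Model. For $i=1,\dots,N$, $t=1,\dots,T$: $y_{i,t}=\sum_{l=1}^L\alpha_ly_{i,t-l}+x_{i,t}'\beta+\eta_i+\varepsilon_{i,t}$, with $x_{i,t}\in\mathbb{R}^{p_x}$ and available initial observations $y_{i,0},\dots,y_{i,1-L}$. Put $z_{i,t}=(y_{i,t-1},\dots,y_{i,t-L},x_{i,t}')'\in\mathbb{R}^p$, $p=p_x+L$, $\alpha=(\alpha_1,\dots,\alpha_L,\beta')'$, so that $y_{i,t}=z_{i,t}'\alpha+\eta_i+\varepsilon_{i,t}$. Let $Z_i=(z_{i,1},\dots,z_{i,T})$ ($p\times T$), $Z=(Z_1,\dots,Z_N)'$ ($NT\times p$), $y_i=(y_{i,1},\dots,y_{i,T})'$, $y=(y_1',\dots,y_N')'$, $\varepsilon_i=(\varepsilon_{i,1},\dots,\varepsilon_{i,T})'$, $\varepsilon=(\varepsilon_1',\dots,\varepsilon_N')'$, $\eta=(\eta_1,\dots,\eta_N)'$, $D=I_N\otimes\iota$ with $\iota$ the $T\times1$ vector of ones, $\Pi=(Z,D)$, $\gamma=(\alpha',\eta')'\in\mathbb{R}^{p+N}$. Then $y=\Pi\gamma+\varepsilon$.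 The quantities $T,L,p_x,p,s_1,E$ may vary with $N$; constants do not depend on $N,T$. Norms: $\|\cdot\|_0$ counts non-zero entries; $\|\cdot\|$, $\|\cdot\|_1$ are the $\ell_2,\ell_1$ norms. $a\vee b=\max(a,b)$, $a\wedge b=\min(a,b)$. $a_n\lesssim b_n$ means $a_n\le Cb_n$ for all $n$ for a fixed finite positive constant $C$. Panel Lasso. $\hat\gamma=(\hat\alpha',\hat\eta')'$ minimises $\|y-\Pi\gamma\|^2+2\lambda_N\|\alpha\|_1+2\frac{\lambda_N}{\sqrt N}\|\eta\|_1$ over $\gamma=(\alpha',\eta')'\in\mathbb{R}^{p+N}$. Let $\Psi_Z=\frac1{NT}\sum_{i=1}^N\sum_{t=1}^T\mathbb{E}[z_{i,t}z_{i,t}']$ and $\kappa_2^2=\kappa_2^2(\Psi_Z,s_1)=1\wedge\min_{R_1\subseteq\{1,\dots,p\},|R_1|\le s_1}\ \min_{\delta_1\in\mathbb{R}^p,\ \delta_{1,R_1}\ne0}\frac{\delta_1'\Psi_Z\delta_1}{\delta_{1,R_1}'\delta_{1,R_1}}$, where $\delta_{1,R_1}$ is the subvector of $\delta_1$ with indices in $R_1$. Assumption 1. $\{(x_{i,1}',\dots,x_{i,T}',\varepsilon_i')\}_{i=1}^N$ is an independent sequence (not necessarily identically distributed), and $\mathbb{E}[\varepsilon_{i,t}\mid y_{i,t-1},\dots,y_{i,1-L},x_{i,t},\dots,x_{i,1}]=0$ for $i=1,\dots,N$, $t=1,\dots,T$. Assumption 2. $\kappa_2^2$ is uniformly bounded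 away from zero. Assumption 3. There are positive constants $C,K$ such that $\mathbb{P}(|\varepsilon_{i,t}|\ge\epsilon)\le\frac12Ke^{-C\epsilon^2}$ and $\mathbb{P}(|z_{i,t,l}|\ge\epsilon)\le\frac12Ke^{-C\epsilon^2}$ for all $\epsilon\ge0$ and all $i,t$ and $l=1,\dots,p$, where $z_{i,t,l}$ is the $l$th entry of $z_{i,t}$.
   Formalization: Independence across i in Assumption 1 is required of the blocks that also contain the initial observations y_{i,0},…,y_{i,1-L}; otherwise the claim fails, e.g. L=T=1, i.i.d. signs ε_i and y_{i,0}=∏_{j≠i}ε_j. *)

(* Defs.v *)
(* MathComp-Analysis, over an arbitrary realType. *)
From HB Require Import structures.
From mathcomp Require Export all_boot all_order all_algebra.
From mathcomp Require Export all_classical all_reals all_analysis.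
Export Order.TTheory GRing.Theory Num.Theory.
Export numFieldNormedType.Exports.

Set Implicit Arguments.
Unset Strict Implicit.
Unset Printing Implicit Defensive.

#[export] Set Implicit Arguments.
#[export] Unset Strict Implicit.
#[export] Unset Printing Implicit Defensive.

Open Scope classical_set_scope.
Open Scope ring_scope.

Section Norms.
Context {R : realType} {n : nat}.
Implicit Type v : 'cV[R]_n.

Definition norm0 v : nat := #|[set k | v k 0 != 0]%SET|.
Definition norm1 v : R := \sum_k `|v k 0|.
Definition norm2 v : R := Num.sqrt (\sum_k v k 0 ^+ 2).
End Norms.

Section SigmaAlgebras.
Context d (Om : measurableType d) (R : realType) (P : probability Om R).

Definition sigma_gen (F : set (Om -> R)) : set (set Om) :=
  <<s \bigcup_(f in F) preimage_set_system setT f measurable >>.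

(* The product rule over the whole index type covers every subfamily, as
   [setT] belongs to each [sigma_gen (F i)]. *)
Definition indep_families (I : finType) (F : I -> set (Om -> R)) : Prop :=
  forall A : I -> set Om, (forall i, sigma_gen (F i) (A i)) ->
    P (\bigcap_i A i) = (\prod_i P (A i))%E.

(* [Y] is a version of the conditional expectation of [X] given [G]. *)
Definition is_cond_exp (G : set (set Om)) (X Y : Om -> R) : Prop :=
  [/\ P.-integrable setT (EFin \o X),
      P.-integrable setT (EFin \o Y),
      forall B : set R, measurable B -> G (Y @^-1` B) &
      forall A, G A -> (\int[P]_(w in A) (X w)%:E = \int[P]_(w in A) (Y w)%:E)%E].
End SigmaAlgebras.

(* [obs i t] is y_{i,t} at calendar date t : int; only the dates
   1 - L <= t <= T matter.  An index t : 'I_T of [cov] or [err] stands for the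
   date t + 1, and an index l : 'I_L for the lag l + 1. *)
Record panel d (Om : measurableType d) (R : realType) (P : probability Om R)
    (N T L px : nat) := Panel {
  obs : 'I_N -> int -> {RV P >-> R};
  cov : 'I_N -> 'I_T -> 'I_px -> {RV P >-> R};
  err : 'I_N -> 'I_T -> {RV P >-> R} }.

Section Model.
Context d (Om : measurableType d) (R : realType) (P : probability Om R).
Context (N T L px : nat) (D : panel P N T L px).

(* The date of the l-th lag is (t + 1) - (l + 1) = t - l. *)
Definition regressor (i : 'I_N) (t : 'I_T) (w : Om) : 'cV[R]_(L + px) :=
  col_mx (\col_(l < L) obs D i (t%:Z - l%:Z) w) (\col_(k < px) cov D i t k w).

Definition panel_model (alpha : 'cV[R]_(L + px)) (eta : 'cV[R]_N) : Prop :=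
  forall (i : 'I_N) (t : 'I_T) (w : Om),
    obs D i (t.+1)%:Z w =
      \sum_(l < L) usubmx alpha l 0 * obs D i (t%:Z - l%:Z) w
      + \sum_(k < px) cov D i t k w * dsubmx alpha k 0
      + eta i 0 + err D i t w.

(* [mxvec] lists an N x T array row by row, i.e. unit by unit. *)
Definition stack (a : 'I_N -> 'I_T -> R) : 'cV[R]_(N * T) :=
  (mxvec (\matrix_(i, t) a i t))^T.

Definition y_vec (w : Om) : 'cV[R]_(N * T) :=
  stack (fun i t => obs D i (t.+1)%:Z w).

Definition Z_mx (w : Om) : 'M[R]_(N * T, L + px) :=
  \matrix_(k, l) stack (fun i t => regressor i t w l 0) k 0.

(* I_N (x) iota *)
Definition D_mx : 'M[R]_(N * T, N) :=
  \matrix_(k, j) stack (fun i _ => (i == j)%:R) k 0.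

Definition Pi_mx (w : Om) : 'M[R]_(N * T, L + px + N) := row_mx (Z_mx w) D_mx.

Definition lasso_objective (lam : R) (w : Om) (g : 'cV[R]_(L + px + N)) : R :=
  norm2 (y_vec w - Pi_mx w *m g) ^+ 2
  + 2 * lam * norm1 (usubmx g)
  + 2 * (lam / Num.sqrt N%:R) * norm1 (dsubmx g).

(* The minimiser need not be unique: any measurable selection is allowed. *)
Definition panel_lasso (lam : R) (ghat : Om -> 'cV[R]_(L + px + N)) : Prop :=
  (forall k, measurable_fun setT (fun w => ghat w k 0)) /\
  (forall w g, lasso_objective lam w (ghat w) <= lasso_objective lam w g).

Definition Psi_Z : 'M[R]_(L + px) :=
  \matrix_(l, m) ((N%:R * T%:R)^-1 * \sum_(i < N) \sum_(t < T)
    fine ('E_P[fun w => (regressor i t w *m (regressor i t w)^T) l m])%E).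

(* All random variables of unit i.  The initial observations
   y_{i,0}, ..., y_{i,1-L} are part of the block; when they are non-random
   this is the block (x_i, eps_i).  If they could depend on the errors of
   other units, Z'eps would not concentrate: for L = T = 1 and independent
   signs eps_i, the choice y_{i,0} = \prod_{j <> i} eps_j is mean-independent
   of eps_i for each i, but y_{i,0} eps_i does not vary with i. *)
Definition unit_block (i : 'I_N) : set (Om -> R) :=
  [set f : Om -> R | (exists l : 'I_L, f = obs D i (- l%:Z))
        \/ (exists t, exists k, f = cov D i t k)
        \/ (exists t, f = err D i t)].

(* y_{i,t-1}, ..., y_{i,1-L}, x_{i,t}, ..., x_{i,1}; the index t is the date
   t + 1, so the last observation is the one of date t. *)
Definition history (i : 'I_N) (t : 'I_T) : set (Om -> R) :=
  [set f : Om -> R | (exists2 s : int, 1 - L%:Z <= s <= t%:Z & f = obs D i s)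
        \/ (exists2 s : 'I_T, (s <= t)%N & exists k, f = cov D i s k)].

Definition assumption1 : Prop :=
  indep_families P unit_block /\
  forall i t, is_cond_exp P (sigma_gen (history i t)) (err D i t) (cst 0).

Definition assumption3 (C K : R) : Prop :=
  forall (e : R), 0 <= e -> forall (i : 'I_N) (t : 'I_T),
    let tail : R := 2^-1 * K * expR (- C * e ^+ 2) in
    (P [set w | (e <= `|err D i t w|)%R] <= tail%:E)%E /\
    forall l : 'I_(L + px),
      (P [set w | (e <= `|regressor i t w l 0|)%R] <= tail%:E)%E.

End Model.

(* kappa_2^2; there is no admissible delta when R1 is empty, so that R1
   contributes nothing to the minimum. *)
Definition kappa2sq (R : realType) (p : nat) (Psi : 'M[R]_p) (s1 : nat) : R :=
  Num.min 1 (inf [set q : R | exists (R1 : {set 'I_p}) (delta : 'cV[R]_p),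
    [/\ (#|R1| <= s1)%N,
        (exists2 l, l \in R1 & delta l 0 != 0) &
        q = (delta^T *m Psi *m delta) 0 0 / \sum_(l in R1) delta l 0 ^+ 2]]).

Definition assumption2 (R : realType) (p : nat) (Psi : 'M[R]_p) (s1 : nat)
  (kap0 : R) : Prop := kap0 <= kappa2sq Psi s1.

Definition lambdaN (R : realType) (M : R) (N T p : nat) : R :=
  Num.sqrt (4 * M * N%:R * T%:R * ln (maxn p N)%:R ^+ 3).

Definition calF (R : realType) (p N s1 : nat) (nu E : R)
    : set ('cV[R]_p * 'cV[R]_N) :=
  [set alpha : 'cV[R]_p | (norm0 alpha <= s1)%N]
  `*` [set eta : 'cV[R]_N | \sum_(i < N) `|eta i 0| `^ nu <= E].
Arguments calF {R} p N s1 nu E.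

(* Main.v *)
Require Import Defs.
From mathcomp Require Import finmap measurable_realfun ring lra zify.

Import HBNNSimple.

(* Everything is reduced to even moments. If [E S^2k <= (a m)^k], [E X^2k <= m^k]
   and [E (S^(2k-1) X) = 0], then [E (S + X)^2k <= ((a + 4k) m)^k]: the linear term
   of the binomial expansion vanishes and Young's inequality bounds the others.
   Hence a sum of [n] orthogonal increments whose [2k]-th moments are at most
   [(c k^2)^k] has [2k]-th moment at most [(c' k^3 n)^k], and Markov's inequality
   with [k] of order [u^(2/3)] bounds the probability that it exceeds [sqrt n * u]
   by a multiple of [exp (- b u^(2/3))]; no conditional expectation of a truncated
   variable is needed. This applies to the scores [Z'eps], ordered
   lexicographically in (unit, date), to [D'eps] and to the centred Gram matrix;
   whence the exponent 1/3 in all probability bounds. On the complement of the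
   exceptional events the oracle inequality is deterministic: the empirical Gram
   matrix differs from the population one by at most [k2 / (50 S)] entrywise, which
   transfers the restricted eigenvalue condition to the cone where the error lies. *)

(** * Elementary inequalities *)

Section Numeric.
Context {R : realType}.
Implicit Types (a b s t x y : R) (k m n j : nat).

(** Only two orthogonality relations are available: an error against functions of its own unit's
    history, and a centred function of one unit against functions of the earlier units. Powers of a
    partial score sum mix both; expanding them binomially into a factor from the earlier units and a
    factor from the current unit separates the two.

    The rescaled design [(Z, sqrt N D)] puts both penalties on one scale. Its normalised Gram matrix
    is compared with the block diagonal matrix of blocks [Psi_Z] and identity. The [Z] block
    averages over [N] independent units and is needed with accuracy of order [1 / S]. The cross
    block is a time average inside one unit divided by [sqrt N]: it need not concentrate, a tail
    bound at level [sqrt N / S] suffices. Both give the exponent [(N / S^2)^(1/3)].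

    At the level [lambdaN] the cube root of [M log^3] appears, that is [M^(1/3)] times the logarithm
    of [max(p, N)], so that union bounds over [p] scores and [N] error sums become powers of [p] and
    [N]. *)

Lemma young_tangent a b n : 0 <= a -> 0 <= b ->
  n.+1%:R * (a * b ^+ n) <= a ^+ n.+1 + n%:R * b ^+ n.+1.
Proof.
move=> a0 b0; elim: n => [|n IH]; first by rewrite !expr1 expr0; lra.
have h : 0 <= (a ^+ n.+1 - b ^+ n.+1) * (a - b).
  have mono u v : 0 <= u -> u <= v -> u ^+ n.+1 <= v ^+ n.+1.
    by move=> u0 uv; rewrite lerXn2r// nnegrE// (le_trans u0).
  case: (lerP a b) => ab.
    rewrite -mulrNN; apply: mulr_ge0; rewrite oppr_ge0 subr_le0; [exact: mono|exact: ab].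
  by apply: mulr_ge0; rewrite subr_ge0; [apply: mono; rewrite // ltW|apply: ltW].
have := ler_wpM2l b0 IH.
rewrite -(natr1 n.+1) -(natr1 n) !exprS in h *; move: (b ^+ n) (a ^+ n) h => u v h; nra.
Qed.

(** Weighted arithmetic-geometric mean inequality. Multiplying the case [n] by [a] leaves
    [a * b ^+ n], which [young_tangent] bounds. *)
Lemma young_pow a b n j : 0 <= a -> 0 <= b -> (j <= n)%N ->
  n%:R * (a ^+ (n - j) * b ^+ j) <= (n - j)%:R * a ^+ n + j%:R * b ^+ n.
Proof.
move=> a0 b0; elim: n j => [|n IH] j.
  by rewrite leqn0 => /eqP->; rewrite !mul0r addr0.
rewrite leq_eqVlt => /predU1P[->|]; first by rewrite subnn mul0r add0r mul1r.
rewrite ltnS => jn; have [n0|n0] := posnP n.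
  by move: jn; rewrite n0 leqn0 => /eqP->; rewrite subn0 mulr1 mul0r addr0.
have := ler_wpM2l a0 (IH _ jn); have := young_tangent n a0 b0.
have jnR : j%:R <= n%:R :> R by rewrite ler_nat.
have n0R : 0 < n%:R :> R by rewrite ltr0n.
have j0R : 0 <= j%:R :> R by [].
rewrite (subSn jn) (exprS a (n - j)) -(natr1 (n - j)) -(natr1 n) natrB//.
set u := a ^+ (n - j) * b ^+ j; rewrite -(mulrA a) -/u.
rewrite !exprS; set v := a ^+ n; set w := b ^+ n.
move: (j%:R : R) (n%:R : R) jnR n0R j0R => J N JN N0 J0 h1 h2.
rewrite -(ler_pM2l N0).
have h3 := ler_wpM2l J0 h1.
have h4 : (N + 1) * (a * (N * u)) <= (N + 1) * (a * ((N - J) * v + J * w)).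
  by apply: ler_wpM2l => //; lra.
nra.
Qed.

(** Convexity in tangent form, from [young_tangent] at absolute values. It serves to cancel odd
    powers and, later, to prove Jensen's inequality. *)
Lemma even_power_tangent x y k : (0 < k)%N ->
  y ^+ k.*2 + k.*2%:R * y ^+ k.*2.-1 * (x - y) <= x ^+ k.*2.
Proof.
case: k => // k _; rewrite doubleS /=.
have := @young_tangent `|x| `|y| k.*2.+1 (normr_ge0 _) (normr_ge0 _).
rewrite -!normrX -normrM.
have e (z : R) : `|z ^+ k.*2.+2| = z ^+ k.*2.+2.
  by apply: ger0_norm; apply: exprn_even_ge0; rewrite /= odd_double.
rewrite !e => h.
have := ler_norm (x * y ^+ k.*2.+1) => h'.
have h2 := ler_wpM2l (ler0n R k.*2.+2) h'.
move: h h2; rewrite -(natr1 k.*2.+1) !(exprS y).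
set v := y ^+ k.*2; nra.
Qed.

(** From [m] to [m + 1] the two sides are multiplied by [(k-m)/(m+1)] times [(2k-2m-1)/(2m+1)] and
    [2k] respectively, and [2k-2m-1 <= (2m+1) 2k]. *)
Lemma bin_even_le k m : ('C(k.*2, m.*2) <= 'C(k, m) * k.*2 ^ m)%N.
Proof.
elim: m => [|m IH]; first by rewrite !bin0.
have e1 := mul_bin_left k.*2 m.*2; have e2 := mul_bin_left k.*2 m.*2.+1.
have e3 := mul_bin_left k m.
rewrite doubleS -(@leq_pmul2l m.+1)// -(@leq_pmul2l m.*2.+1)// -(@leq_pmul2l 2)//.
have -> : (2 * (m.*2.+1 * (m.+1 * 'C(k.*2, m.*2.+2))) =
   (k.*2 - m.*2.+1) * ((k.*2 - m.*2) * 'C(k.*2, m.*2)))%N.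
  by rewrite -e1 [RHS]mulnCA -e2; lia.
have -> : (2 * (m.*2.+1 * (m.+1 * ('C(k, m.+1) * k.*2 ^ m.+1))) =
   (m.*2.+1 * k.*2) * ((k.*2 - m.*2) * ('C(k, m) * k.*2 ^ m)))%N.
  have -> : (k.*2 - m.*2 = 2 * (k - m))%N by lia.
  rewrite expnS; transitivity (2 * m.*2.+1 * k.*2 * k.*2 ^ m * (m.+1 * 'C(k, m.+1)))%N.
    by ring.
  by rewrite e3; ring.
apply: leq_mul; first by lia.
by apply: leq_mul.
Qed.

Lemma sum_parity (F : nat -> R) k :
  \sum_(j < k.*2.+1) F j = \sum_(m < k.+1) F m.*2 + \sum_(m < k) F m.*2.+1.
Proof.
elim: k => [|k IH]; first by rewrite !big_ord_recr !big_ord0 /= addr0.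
by rewrite doubleS 2!big_ord_recr /= IH [in RHS]big_ord_recr [in X in _ + X = _]/= 
  [\sum_(m < k.+1) F m.*2.+1]big_ord_recr /= doubleS; ring.
Qed.

(* Adding the nonnegative term [(s - t)^2k - s^2k + 2k s^(2k-1) t] cancels the odd powers of [t]. *)
Lemma binomial_step s t k : (0 < k)%N -> 0 <= s -> 0 <= t ->
  (s + t) ^+ k.*2 - k.*2%:R * s ^+ k.*2.-1 * t
    <= (s ^+ 2 + (4 * k)%:R * t ^+ 2) ^+ k.
Proof.
move=> k0 s0 t0.
have h := even_power_tangent (s - t) s k0.
apply: (@le_trans _ _ ((s + t) ^+ k.*2 + (s - t) ^+ k.*2 - s ^+ k.*2)).
  move: h; set u := _ ^+ _.-1; nra.
rewrite exprDn exprBn -big_split /=.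
pose F j := (s ^+ (k.*2 - j) * t ^+ j) *+ 'C(k.*2, j) +
            ((-1) ^+ j * s ^+ (k.*2 - j) * t ^+ j) *+ 'C(k.*2, j).
rewrite (sum_parity F) [X in _ + X - _]big1 ?addr0; last first.
  by move=> i _; rewrite /F /= -signr_odd /= odd_double expr1 mulN1r mulNr mulNrn addrN.
rewrite exprDn 2!big_ord_recl /F /= double0 !bin0 !subn0 !expr0 !mulr1 mul1r.
rewrite -exprM mul2n !mulr1n addrAC addrK lerD2l; apply: ler_sum => i _.
rewrite /bump /= add1n -signr_odd odd_double expr0 mul1r -mulr2n -mulrnA.
rewrite [((4 * k)%:R * _) ^+ _]exprMn -!exprM.
rewrite [(2 * (k - _))%N]mul2n [(2 * i.+1)%N]mul2n -doubleB -natrX mulrCA.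
rewrite -[leLHS]mulr_natl.
rewrite -[leRHS]mulr_natl [leRHS]mulrA -natrM.
apply: ler_wpM2r; first by rewrite mulr_ge0// exprn_ge0.
(* The factor 2 comes from adding the two expansions; it is absorbed by [4 * k = k.*2 * 2], as
   [2 <= 2 ^ i.+1]. *)
rewrite ler_nat; apply: (@leq_trans ('C(k, i.+1) * k.*2 ^ i.+1 * 2)).
  by rewrite leq_mul2r bin_even_le orbT.
rewrite -mulnA leq_mul2l; apply/orP; right.
have -> : (4 * k = k.*2 * 2)%N by lia.
by rewrite expnMn leq_mul2l -{1}(expn1 2) leq_pexp2l// orbT.
Qed.

(** Young's inequality in [x / s] and [y / t] on every binomial term but the linear one. It is an
    equality at [x = s], [y = t], so the coefficients, which do not depend on [x] and [y], add up to
    exactly the binomial remainder; the bound can thus be integrated. *)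
Lemma moment_step_pointwise (s t : R) k : (0 < k)%N -> 0 < s -> 0 < t ->
  exists ca cb : R, [/\ 0 <= ca, 0 <= cb,
    ca * s ^+ k.*2 + cb * t ^+ k.*2 = (s + t) ^+ k.*2 - k.*2%:R * s ^+ k.*2.-1 * t &
    forall x y, (x + y) ^+ k.*2 <=
      k.*2%:R * (x ^+ k.*2.-1 * y) + (ca * x ^+ k.*2 + cb * y ^+ k.*2)].
Proof.
move=> k0 s0 t0; pose n := k.*2.
have n1 : (1 < n.+1)%N by rewrite ltnS double_gt0.
have nR : 0 < n%:R :> R by rewrite ltr0n double_gt0.
pose w (j : nat) : R := s ^+ (n - j) * t ^+ j *+ 'C(n, j).
have w0 j : 0 <= w j by rewrite mulrn_wge0// mulr_ge0// exprn_ge0// ltW.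
have sn0 : 0 < s ^+ n by rewrite exprn_gt0.
have tn0 : 0 < t ^+ n by rewrite exprn_gt0.
exists (\sum_(j < n.+1 | j != Ordinal n1) w j * (n - j)%:R / n%:R / s ^+ n),
  (\sum_(j < n.+1 | j != Ordinal n1) w j * j%:R / n%:R / t ^+ n); split.
- by apply: sumr_ge0 => j _; apply: divr_ge0 (ltW sn0); apply: divr_ge0 (ltW nR); apply: mulr_ge0.
- by apply: sumr_ge0 => j _; apply: divr_ge0 (ltW tn0); apply: divr_ge0 (ltW nR); apply: mulr_ge0.
- rewrite !mulr_suml -big_split exprDn [X in _ = X - _](bigD1 (Ordinal n1))//=.
  rewrite bin1 subn1 expr1 -mulrA mulr_natl addrAC subrr add0r.
  apply: eq_bigr => j _; rewrite !divfK ?gt_eqF// -mulrDl -mulrDr -natrD subnK ?mulfK ?gt_eqF//.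
  by rewrite -ltnS.
- move=> x y; rewrite exprDn (bigD1 (Ordinal n1))//= bin1 subn1 expr1 -mulr_natl.
  rewrite lerD2l !mulr_suml -big_split /=; apply: ler_sum => j _.
  have jn : (j <= n)%N by rewrite -ltnS.
  have h := young_pow (divr_ge0 (normr_ge0 x) (ltW s0)) (divr_ge0 (normr_ge0 y) (ltW t0)) jn.
  have h1 : s ^+ (n - j) * t ^+ j * ((`|x| / s) ^+ (n - j) * (`|y| / t) ^+ j) =
     `|x ^+ (n - j) * y ^+ j|.
    rewrite normrM !normrX !exprMn !exprVn; field.
    by rewrite !expf_neq0// gt_eqF.
  apply: (@le_trans _ _ (w j * ((`|x| / s) ^+ (n - j) * (`|y| / t) ^+ j))).
    by rewrite /w mulrnAl lerMn2r h1 ler_norm orbT.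
  have en (z : R) : `|z| ^+ n = z ^+ n.
    by rewrite -normrX; apply: ger0_norm; apply: exprn_even_ge0; rewrite odd_double.
  move: h; rewrite -(ler_pM2l nR) !exprMn !en !exprVn => h.
  have -> : w j * (n - j)%:R / n%:R / s ^+ n * x ^+ n + w j * j%:R / n%:R / t ^+ n * y ^+ n
    = w j * (((n - j)%:R * (x ^+ n / s ^+ n) + j%:R * (y ^+ n / t ^+ n)) / n%:R).
    by field; rewrite !gt_eqF.
  apply: ler_wpM2l => //; rewrite ler_pdivlMr// mulrC -(ler_pM2l nR)//.
Qed.

(** The order in Markov's inequality is [k], the integer part of [y]. Then
    [c k^3 <= c b^3 q <= q / e], so the [k]-th power gains [exp (- k)]; rounding costs the factor
    [expR 1]. If [k = 0], the target bound is at least 1. *)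
Lemma tail_choice (c b q : R) : 0 < c -> 0 < b -> b ^+ 3 * (c * expR 1) <= 1 -> 0 < q ->
  let y := b * q `^ (3^-1) in
  1 <= expR 1 * expR (- y) \/
  exists2 k, (0 < k)%N & (c * k%:R ^+ 3) ^+ k <= expR 1 * expR (- y) * q ^+ k.
Proof.
move=> c0 b0 bc q0 y.
have y0 : 0 <= y by rewrite mulr_ge0 ?powR_ge0 ?ltW.
have q3 : (q `^ 3^-1) ^+ 3 = q.
  by rewrite -powR_mulrn ?powR_ge0// -powRrM mulVf// powRr1// ltW.
have /andP[ky yk] := truncn_itv y0; set k := Num.truncn y in ky yk.
have ek : expR (- k%:R) <= expR 1 * expR (- y).
  by rewrite -expRD ler_expR; move: yk; rewrite -natr1; lra.
have [k0|k0] := posnP k; first by left; move: ek; rewrite k0 oppr0 expR0.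
right; exists k => //.
have ck : c * k%:R ^+ 3 <= expR (-1) * q.
  have : k%:R ^+ 3 <= y ^+ 3 by rewrite lerXn2r// nnegrE.
  rewrite /y exprMn q3 => h; rewrite expRN [leRHS]mulrC ler_pdivlMr ?expR_gt0// [leLHS]mulrC.
  apply: le_trans (_ : expR 1 * (c * (b ^+ 3 * q)) <= _).
    by rewrite ler_pM2l ?expR_gt0// ler_pM2l.
  rewrite (_ : _ * _ = b ^+ 3 * (c * expR 1) * q); last by ring.
  by rewrite -[leRHS]mul1r ler_pM2r.
apply: le_trans (_ : (expR (-1) * q) ^+ k <= _).
  by rewrite lerXn2r// nnegrE ?mulr_ge0// ?exprn_ge0 ?expR_ge0 ?ltW.
rewrite exprMn -expRM_natr mulN1r; apply: ler_wpM2r => //.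
by rewrite exprn_ge0// ltW.
Qed.
End Numeric.

(** * Even moments *)

Section Moments.
Context d (Om : measurableType d) (R : realType) (P : probability Om R).
Implicit Types (f g X Y S : Om -> R).
Local Notation Ex := (Rintegral P setT).
Local Notation integrable1 f := (P.-integrable setT (EFin \o f)).

Lemma integrable_dominated f g : measurable_fun setT f ->
  (forall w, `|f w| <= g w) -> integrable1 g -> integrable1 f.
Proof.
move=> mf fg ig; apply: le_integrable ig => //; first exact/measurable_EFinP.
by move=> w _ /=; rewrite lee_fin (le_trans (fg w))// ler_norm.
Qed.

Lemma integrable_sum (I : Type) (r : seq I) (Q : pred I) (F : I -> Om -> R) :
  (forall i, Q i -> integrable1 (F i)) -> integrable1 (fun w => \sum_(i <- r | Q i) F i w).
Proof.
move=> iF; rewrite (_ : EFin \o _ = fun w => (\sum_(i <- r | Q i) (EFin \o F i) w)%E).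
  by apply: (lebesgue_integrable.integrable_sum measurableT) => i; exact: iF.
by apply/funext => w /=; rewrite sumEFin.
Qed.

Lemma integrable_addr f g : integrable1 f -> integrable1 g ->
  integrable1 (fun w => f w + g w).
Proof. by move=> fi gi; apply: (integrableD _ fi gi). Qed.

Lemma integrable_scale c f : integrable1 f -> integrable1 (fun w => c * f w).
Proof. by move=> fi; apply: (integrableZl _ c fi). Qed.

Lemma integrable_constant c : integrable1 (fun=> c).
Proof. exact: finite_measure_integrable_cst. Qed.

Lemma Ex_cst c : Ex (fun=> c) = c.
Proof. by rewrite Rintegral_cst//= probability_setT /= mulr1. Qed.

Lemma Ex_sum (I : Type) (r : seq I) (Q : pred I) (F : I -> Om -> R) :
  (forall i, Q i -> integrable1 (F i)) ->
  Ex (fun w => \sum_(i <- r | Q i) F i w) = \sum_(i <- r | Q i) Ex (F i).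
Proof.
move=> iF; elim: r => [|i r IH].
  by under eq_Rintegral do rewrite big_nil; rewrite Ex_cst big_nil.
rewrite big_cons; under eq_Rintegral do rewrite big_cons.
case: ifP => // Qi; rewrite -IH RintegralD//; first exact: iF.
exact: integrable_sum.
Qed.

(** An algebra of random variables: closure under sums and products settles the integrability of
    every polynomial expression met below. *)
Definition all_moments f :=
  measurable_fun setT f /\ forall k, integrable1 (fun w => f w ^+ k).

Lemma eq_all_moments f g : f =1 g -> all_moments f -> all_moments g.
Proof. by move=> /funext ->. Qed.

Lemma all_moments_integrable f : all_moments f -> integrable1 f.
Proof. by move=> [_ /(_ 1%N)]. Qed.

Lemma all_moments_even f : measurable_fun setT f ->
  (forall k, integrable1 (fun w => f w ^+ k.*2)) -> all_moments f.
Proof.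
move=> mf h; split=> // k.
apply: (@integrable_dominated _ (fun w => 1 + f w ^+ k.*2)).
- exact: measurable_funX.
- move=> w; rewrite normrX -mul2n mulnC exprM -(real_normK (num_real (f w ^+ k))) normrX.
  set z := `|f w| ^+ k; nra.
- by apply: integrable_addr; [exact: integrable_constant|exact: h].
Qed.

Lemma all_moments_cst c : all_moments (fun=> c).
Proof. by split=> [|k]; [exact: measurable_cst|exact: integrable_constant]. Qed.

Lemma all_moments_X f n : all_moments f -> all_moments (fun w => f w ^+ n).
Proof.
move=> [mf hf]; split=> [|k]; first exact: measurable_funX.
by under [X in _.-integrable _ X]eq_fun do rewrite /= -exprM; exact: hf.
Qed.

Lemma all_moments_M f g : all_moments f -> all_moments g ->
  all_moments (fun w => f w * g w).
Proof.
move=> [mf hf] [mg hg]; split=> [|k]; first exact: measurable_funM.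
apply: (@integrable_dominated _ (fun w => f w ^+ (k * 2) + g w ^+ (k * 2))).
- by apply: measurable_funX; exact: measurable_funM.
- move=> w; rewrite !exprM exprMn normrM -(real_normK (num_real (f w ^+ k))).
  rewrite -(real_normK (num_real (g w ^+ k))).
  set u := `|_|; set v := `|g w ^+ k|; have := sqr_ge0 (u - v); nra.
- by apply: integrable_addr; [exact: hf|exact: hg].
Qed.

Lemma all_moments_D f g : all_moments f -> all_moments g ->
  all_moments (fun w => f w + g w).
Proof.
move=> hf hg; split=> [|k].
  by apply: measurable_funD; [case: hf|case: hg].
under [X in _.-integrable _ X]eq_fun do rewrite /= exprDn.
apply: integrable_sum => i _.
under [X in _.-integrable _ X]eq_fun do rewrite /= -mulr_natl.
apply: integrable_scale.
by apply: all_moments_integrable; apply: all_moments_M; exact: all_moments_X.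
Qed.

Lemma all_moments_Z c f : all_moments f -> all_moments (fun w => c * f w).
Proof. by move=> hf; apply: all_moments_M => //; exact: all_moments_cst. Qed.

Lemma all_moments_sum (I : Type) (r : seq I) (Q : pred I) (F : I -> Om -> R) :
  (forall i, Q i -> all_moments (F i)) -> all_moments (fun w => \sum_(i <- r | Q i) F i w).
Proof.
move=> hF; elim: r => [|i r IH].
  by apply: eq_all_moments (all_moments_cst 0) => w; rewrite big_nil.
have [Qi|Qi] := boolP (Q i); last first.
  by apply: eq_all_moments IH => w; rewrite big_cons (negbTE Qi).
by apply: eq_all_moments (all_moments_D (hF _ Qi) IH) => w; rewrite big_cons Qi.
Qed.

Lemma even_pow_ge0 (x : R) k : 0 <= x ^+ k.*2.
Proof. by apply: exprn_even_ge0; rewrite odd_double. Qed.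

Lemma measurable_abs_ge X u : measurable_fun setT X -> measurable [set w | u <= `|X w|].
Proof.
move=> mX; rewrite -[X in measurable X]setTI.
by apply: measurable_fun_le => //; exact: measurableT_comp.
Qed.

Lemma markov_even X (u b : R) k : all_moments X -> 0 < u ->
  Ex (fun w => X w ^+ k.*2) <= b ->
  fine (P [set w | u <= `|X w|]) <= b / u ^+ k.*2.
Proof.
move=> hX u0 Xb; have [mX iX] := hX.
have mA := measurable_abs_ge u mX.
set A := [set w | _] in mA *.
rewrite ler_pdivlMr ?exprn_gt0// mulrC; apply: le_trans Xb.
rewrite -(Rintegral_cst P mA) Rintegral_mkcond; apply: le_Rintegral => //.
- apply: (@integrable_dominated _ (fun=> u ^+ k.*2)) => //.
  + by apply/(measurable_restrictT _ mA) => //; exact: measurable_cst.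
  + move=> w; rewrite patchE; case: ifP => _; rewrite ger0_norm ?even_pow_ge0//.
  + exact: integrable_constant.
- move=> w _; rewrite patchE; case: ifPn => [/set_mem Aw|_]; last exact: even_pow_ge0.
  have := even_pow_ge0 (X w) k => /ger0_norm <-; rewrite normrX.
  by rewrite lerXn2r// nnegrE ?ltW.
Qed.

(* [a] is a variance proxy, [m2] bounds the normalised moments of the increment. *)
Lemma moment_step S X k (a m2 : R) : (0 < k)%N -> 0 < a -> 0 < m2 ->
  all_moments S -> all_moments X ->
  Ex (fun w => S w ^+ k.*2) <= (a * m2) ^+ k ->
  Ex (fun w => X w ^+ k.*2) <= m2 ^+ k ->
  Ex (fun w => S w ^+ k.*2.-1 * X w) = 0 ->
  Ex (fun w => (S w + X w) ^+ k.*2) <= ((a + (4 * k)%:R) * m2) ^+ k.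
Proof.
move=> k0 a0 m0 hS hX bS bX orth.
(* With these scales the two moment bounds are [s ^+ k.*2] and [t ^+ k.*2], the point where the
   pointwise bound is tight; [binomial_step] then applies. *)
pose s := Num.sqrt (a * m2); pose t := Num.sqrt m2.
have s0 : 0 < s by rewrite sqrtr_gt0 mulr_gt0.
have t0 : 0 < t by rewrite sqrtr_gt0.
have s2 : s ^+ 2 = a * m2 by rewrite sqr_sqrtr// mulr_ge0// ltW.
have t2 : t ^+ 2 = m2 by rewrite sqr_sqrtr// ltW.
have sk : s ^+ k.*2 = (a * m2) ^+ k by rewrite -mul2n exprM s2.
have tk : t ^+ k.*2 = m2 ^+ k by rewrite -mul2n exprM t2.
have [ca [cb [ca0 cb0 cE h]]] := moment_step_pointwise k0 s0 t0.
have iS : integrable1 (fun w => S w ^+ k.*2) by case: hS.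
have iX : integrable1 (fun w => X w ^+ k.*2) by case: hX.
have iSX : integrable1 (fun w => S w ^+ k.*2.-1 * X w).
  by apply: all_moments_integrable; apply: all_moments_M => //; exact: all_moments_X.
apply: le_trans (_ : Ex (fun w => k.*2%:R * (S w ^+ k.*2.-1 * X w) +
   (ca * S w ^+ k.*2 + cb * X w ^+ k.*2)) <= _).
  apply: le_Rintegral => //.
  - by have [_] := all_moments_D hS hX; apply.
  - by apply: integrable_addr; [|apply: integrable_addr]; exact: integrable_scale.
rewrite (RintegralD _ (integrable_scale _ iSX)
  (integrable_addr (integrable_scale _ iS) (integrable_scale _ iX)))//.
rewrite (RintegralD _ (integrable_scale _ iS) (integrable_scale _ iX))//.
rewrite !RintegralZl// orth mulr0 add0r.
apply: le_trans (_ : ca * s ^+ k.*2 + cb * t ^+ k.*2 <= _).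
  by rewrite sk tk lerD// ler_wpM2l.
rewrite cE; apply: le_trans (binomial_step k0 (ltW s0) (ltW t0)) _.
by rewrite s2 t2 -mulrDl.
Qed.

Lemma moment_tail X (c b v q : R) : all_moments X -> 0 < c -> 0 < b -> 0 < v -> 0 < q ->
  b ^+ 3 * (c * expR 1) <= 1 ->
  (forall k, (0 < k)%N -> Ex (fun w => X w ^+ k.*2) <= (c * k%:R ^+ 3 * v) ^+ k) ->
  fine (P [set w | Num.sqrt (v * q) <= `|X w|]) <= expR 1 * expR (- (b * q `^ (3^-1))).
Proof.
move=> hX c0 b0 v0 q0 bc bX.
have vq : 0 < v * q by rewrite mulr_gt0.
have [h|[k k0 h]] := tail_choice c0 b0 bc q0.
  apply: le_trans h.
  have mA := measurable_abs_ge (Num.sqrt (v * q)) hX.1.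
  by rewrite -lee_fin fineK ?fin_num_measure// probability_le1.
have := markov_even hX _ (bX k k0) => /(_ (Num.sqrt (v * q))).
rewrite sqrtr_gt0 => /(_ vq) /le_trans; apply.
rewrite -mul2n exprM (sqr_sqrtr (ltW vq)) ler_pdivrMr ?exprn_gt0//.
rewrite (exprMn _ (c * _)) (exprMn _ v) [v ^+ k * _]mulrC [leRHS]mulrA.
by apply: ler_wpM2r => //; rewrite exprn_ge0// ltW.
Qed.
End Moments.

(** * Orthogonality and independence *)

Section GeneratedMeasurability.
Context d (Om : measurableType d) (R : realType) (G : set (set Om)).
Implicit Types f g : Om -> R.

(** Stated on the type carrying the sigma-algebra generated by [G], so that the closure properties
    of measurable real functions apply as they are. *)
Definition gen_measurable f := @measurable_fun _ _ (g_sigma_algebraType G) R setT f.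

Lemma gen_measurableP f :
  gen_measurable f <-> forall B, measurable B -> <<s G >> (f @^-1` B).
Proof.
split=> [mf B mB|h _ B mB]; last by rewrite setTI; exact: h.
by have := mf measurableT B mB; rewrite setTI.
Qed.

Lemma gen_measurable_cst (c : R) : gen_measurable (fun=> c).
Proof. exact: measurable_cst. Qed.

Lemma gen_measurableD f g : gen_measurable f -> gen_measurable g ->
  gen_measurable (fun w => f w + g w).
Proof. by move=> mf mg; exact: measurable_funD. Qed.

Lemma gen_measurableB f g : gen_measurable f -> gen_measurable g ->
  gen_measurable (fun w => f w - g w).
Proof. by move=> mf mg; exact: measurable_funB. Qed.

Lemma gen_measurableM f g : gen_measurable f -> gen_measurable g ->
  gen_measurable (fun w => f w * g w).
Proof. by move=> mf mg; exact: measurable_funM. Qed.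

Lemma gen_measurableX f n : gen_measurable f -> gen_measurable (fun w => f w ^+ n).
Proof. by move=> mf; exact: measurable_funX. Qed.

Lemma gen_measurable_sum (I : Type) (r : seq I) (Q : pred I) (F : I -> Om -> R) :
  (forall i, Q i -> gen_measurable (F i)) ->
  gen_measurable (fun w => \sum_(i <- r | Q i) F i w).
Proof.
move=> hF; elim: r => [|i r IH].
  rewrite (_ : (fun _ => _) = fun=> 0); first exact: gen_measurable_cst.
  by apply/funext => w; rewrite big_nil.
have [Qi|Qi] := boolP (Q i); last first.
  rewrite (_ : (fun _ => _) = fun w => \sum_(i <- r | Q i) F i w)//.
  by apply/funext => w; rewrite big_cons (negbTE Qi).
rewrite (_ : (fun _ => _) = fun w => F i w + \sum_(i <- r | Q i) F i w).
  by apply: gen_measurableD IH; exact: hF.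
by apply/funext => w; rewrite big_cons Qi.
Qed.
End GeneratedMeasurability.

Section Orthogonality.
Context d (Om : measurableType d) (R : realType) (P : probability Om R).
Implicit Types (f g h : Om -> R).
Local Notation Ex := (Rintegral P setT).
Local Notation integrable1 f := (P.-integrable setT (EFin \o f)).

Lemma integrable_indic_mul (A : set Om) h : measurable A -> integrable1 h ->
  integrable1 (fun w => \1_A w * h w).
Proof.
move=> mA ih; apply: (@integrable_dominated _ _ _ _ _ (fun w => `|h w|)).
- apply: measurable_funM => //; apply/measurable_EFinP; exact: measurable_int ih.
- move=> w; rewrite normrM indicE; case: (_ \in _); rewrite ?normr1 ?mul1r//.
  by rewrite normr0 mul0r.
- exact: (integrable_norm ih).
Qed.

Lemma orthogonal_nnsfun g h (phi : {nnsfun R >-> R}) :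
  measurable_fun setT g -> integrable1 h ->
  (forall B, measurable B -> Ex (fun w => \1_B (g w) * h w) = 0) ->
  integrable1 (fun w => phi (g w) * h w) /\ Ex (fun w => phi (g w) * h w) = 0.
Proof.
move=> mg ih hB.
have -> : (fun w => phi (g w) * h w) =
   fun w => \sum_(y <- fset_set (range phi)) y * (\1_(phi @^-1` [set y]) (g w) * h w).
  apply/funext => w; rewrite [in LHS]fimfunE fsbig_finite//= mulr_suml.
  by apply: eq_bigr => y _; rewrite mulrA.
have mphi y : measurable (phi @^-1` [set y]) by exact: measurable_funPTI.
have i1 y : integrable1 (fun w => \1_(phi @^-1` [set y]) (g w) * h w).
  have := @integrable_indic_mul (g @^-1` (phi @^-1` [set y])) h.
  apply => //; rewrite -[X in measurable X]setTI; exact: mg.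
split; first by apply: integrable_sum => y _; exact: integrable_scale.
rewrite Ex_sum => [|y _]; last exact: integrable_scale.
by apply: big1 => y _; rewrite RintegralZl// hB// mulr0.
Qed.

(** Simple functions below [phi] and converging to it give integrands dominated by
    [|phi (g w) * h w|], all of integral zero. *)
Lemma orthogonal_ge0 g h (phi : R -> R) :
  measurable_fun setT g -> measurable_fun setT phi -> (forall x, 0 <= phi x) ->
  integrable1 h -> integrable1 (fun w => phi (g w) * h w) ->
  (forall B, measurable B -> Ex (fun w => \1_B (g w) * h w) = 0) ->
  Ex (fun w => phi (g w) * h w) = 0.
Proof.
move=> mg mphi phi0 ih ipgh hB.
have mE : measurable_fun setT (EFin \o phi) by exact/measurable_EFinP.
pose s n := nnsfun_approx measurableT mE n.
have sle n x : s n x <= phi x.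
  by rewrite -lee_fin /s nnsfun_approxE; apply: le_approx => //= y _; rewrite lee_fin.
have scvg x : s n x @[n --> \oo] --> phi x.
  have : forall y, setT y -> (0 <= (EFin \o phi) y)%E by move=> y _; rewrite lee_fin.
  by move=> /(cvg_nnsfun_approx measurableT mE)/(_ x Logic.I)/fine_cvgP[_].
have h0 n := orthogonal_nnsfun (s n) mg ih hB.
have mint f : integrable1 f -> measurable_fun setT (EFin \o f) by exact: measurable_int.
have := @dominated_convergence _ _ _ P setT measurableT
  (fun n w => (s n (g w) * h w)%:E) (fun w => (phi (g w) * h w)%:E)
  (fun w => `|phi (g w) * h w|%:E).
case=> //.
- by move=> n; apply: mint; case: (h0 n).
- exact: mint.
- apply: aeW => w _ /=; apply: cvg_EFin; first exact: nearW.
  by apply: cvgM => //; exact: cvg_cst.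
- exact: (integrable_norm ipgh).
- apply: aeW => w n _; rewrite lee_fin !normrM; apply: ler_wpM2r => //.
  by rewrite !ger0_norm.
move=> _ _ lim.
rewrite /Rintegral (_ : (\int[P]_x _)%E = 0%E)//.
apply: (cvg_unique _ lim) => //; apply: cvg_near_cst; apply: nearW => n; have [i0 e0] := h0 n.
by rewrite -[LHS]fineK; [congr EFin; exact: e0|exact: integrable_fin_num].
Qed.

(* The hypothesis gives the claim for simple functions of [g]; dominated convergence
   does the rest. *)
Lemma orthogonal g h :
  measurable_fun setT g -> integrable1 h -> integrable1 (fun w => g w * h w) ->
  (forall B, measurable B -> Ex (fun w => \1_B (g w) * h w) = 0) ->
  Ex (fun w => g w * h w) = 0.
Proof.
move=> mg ih igh hB.
have mint f : integrable1 f -> measurable_fun setT f.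
  by move=> i; apply/measurable_EFinP; exact: measurable_int i.
(* Splitting the real argument keeps both parts of the form [phi (g w)] with [phi] nonnegative. *)
pose p (x : R) := Num.max x 0; pose n (x : R) := Num.max (- x) 0.
have mp : measurable_fun setT p by exact: measurable_maxr.
have mn : measurable_fun setT n.
  by apply: measurable_maxr => //; exact: measurable_oppr.
have p0 x : 0 <= p x by rewrite le_max lexx orbT.
have n0 x : 0 <= n x by rewrite le_max lexx orbT.
have pn x : x = p x - n x.
  by rewrite /p /n; case: (lerP 0 x) => hx; rewrite /Num.max; do 2 case: ltP; lra.
have bp x : `|p x| <= `|x| by rewrite ger0_norm// /p ge_max ler_norm normr_ge0.
have bn x : `|n x| <= `|x|.
  by rewrite ger0_norm// /n ge_max normr_ge0 -normrN ler_norm.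
have i1 (phi : R -> R) : measurable_fun setT phi -> (forall x, `|phi x| <= `|x|) ->
    integrable1 (fun w => phi (g w) * h w).
  move=> mphi bphi; apply: (@integrable_dominated _ _ _ _ _ (fun w => `|g w * h w|)).
  - by apply: measurable_funM; [exact: measurableT_comp|exact: mint].
  - by move=> w; rewrite !normrM ler_wpM2r.
  - exact: (integrable_norm igh).
have -> : (fun w => g w * h w) = fun w => p (g w) * h w - n (g w) * h w.
  by apply/funext => w; rewrite -mulrBl -pn.
rewrite RintegralB//; [|exact: i1..].
by rewrite !orthogonal_ge0 ?subr0//; exact: i1.
Qed.

Lemma Ex_indic (A : set Om) : measurable A -> Ex \1_A = fine (P A).
Proof. by move=> mA; rewrite /Rintegral integral_indic// setIT. Qed.

(** * From independent blocks to orthogonality *)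

Section Independence.
Context (I : finType) (F : I -> set (Om -> R)) (J : pred I).
Hypothesis Fmeas : forall i f, F i f -> measurable_fun setT f.
Hypothesis Find : indep_families P F.

(** A pi-system generating the information of the blocks in [J]. Full families, equal to [setT]
    outside [J], fit the product rule of [indep_families]. *)
Definition joint_events : set (set Om) := [set B | exists A : I -> set Om,
  [/\ forall i, sigma_gen (F i) (A i), forall i, ~~ J i -> A i = setT &
      B = \bigcap_i A i] ].

Lemma sigma_gen_measurable i A : sigma_gen (F i) A -> measurable A.
Proof.
apply: smallest_sub; first exact: sigma_algebra_measurable.
by move=> _ [f Ff [B mB <-]]; exact: (Fmeas Ff).
Qed.

Lemma sigma_genT i : sigma_gen (F i) setT.
Proof. exact: (@measurableT _ (g_sigma_algebraType _)). Qed.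

Lemma sigma_genI i A B : sigma_gen (F i) A -> sigma_gen (F i) B -> sigma_gen (F i) (A `&` B).
Proof. exact: (@measurableI _ (g_sigma_algebraType _)). Qed.

Lemma joint_events_sigma_gen i A : J i -> sigma_gen (F i) A -> joint_events A.
Proof.
move=> Ji sA; exists (fun j => if j == i then A else setT); split.
- by move=> j; case: eqP => [->|_]//; exact: sigma_genT.
- by move=> j; case: eqP => // ->; rewrite Ji.
- apply/seteqP; split=> w; first by move=> Aw j _; case: eqP.
  by move=> /(_ i Logic.I); rewrite eqxx.
Qed.

Lemma joint_events_measurable : joint_events `<=` measurable.
Proof.
move=> _ [A [sA _ ->]]; apply: fin_bigcap_measurable; first exact: finite_finset.
by move=> i _; exact: sigma_gen_measurable (sA i).
Qed.

Lemma joint_events_setI : setI_closed joint_events.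
Proof.
move=> _ _ [A [sA tA ->]] [B [sB tB ->]]; exists (fun i => A i `&` B i); split.
- by move=> i; exact: sigma_genI.
- by move=> i Ji; rewrite tA// tB// setTI.
- by rewrite bigcapI.
Qed.

(** As functions of [B] both sides are finite measures, so agreement on the pi-system extends to the
    sigma-algebra it generates. *)
Lemma indep_joint_events i A B : ~~ J i -> sigma_gen (F i) A -> <<s joint_events >> B ->
  P (A `&` B) = (P A * P B)%E.
Proof.
move=> Ji sA; have mA := sigma_gen_measurable sA.
have PA : P A \is a fin_num by exact: fin_num_measure.
pose m1 := mrestr P mA.
pose c : {nonneg R} := NngNum (fine_ge0 (measure_ge0 P A)).
pose m2 := mscale c P.
have m2E E : m2 E = (P A * P E)%E by rewrite -[P A]fineK.
have jT : joint_events setT.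
  exists (fun=> setT); split=> // [j|]; first exact: sigma_genT.
  by apply/seteqP; split.
have key : forall E, <<s joint_events >> E -> m1 E = m2 E.
  apply: (g_sigma_algebra_measure_unique _ joint_events_measurable (fun=> setT)) => //.
  - by rewrite bigcup_const.
  - exact: joint_events_setI.
  - move=> _ [C [sC tC ->]]; rewrite -[RHS]/(m2 _) m2E -[LHS]/(P (_ `&` A)).
    (* [C i] is [setT] because [i] is outside [J], so [A] can take its place in the family. *)
    pose C' j := if j == i then A else C j.
    have -> : \bigcap_i C i `&` A = \bigcap_i C' i.
      apply/seteqP; split=> w.
        by move=> [Cw Aw] j _; rewrite /C'; case: eqP => // _; exact: Cw.
      move=> Cw; split=> [j _|]; last by have := Cw i Logic.I; rewrite /C' eqxx.
      have := Cw j Logic.I; rewrite /C'; case: eqP => // -> _.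
      by rewrite tC.
    rewrite !Find//; last by move=> j; rewrite /C'; case: eqP => [->|].
    rewrite (bigD1 i)//= [in RHS](bigD1 i)//= tC// probability_setT mul1e /C' eqxx.
    by congr *%E; apply: eq_bigr => j /negbTE ->.
  - by move=> _; rewrite /m1 /= /mrestr setTI (le_lt_trans (probability_le1 P mA))// ltry.
move=> sB; have := key B sB.
by rewrite -[RHS]/(m2 _) m2E -[LHS]/(P (_ `&` A)) setIC.
Qed.

Lemma joint_gen_measurable f : gen_measurable joint_events f -> measurable_fun setT f.
Proof.
move=> /gen_measurableP h _ B mB; rewrite setTI.
apply: (smallest_sub (sigma_algebra_measurable _) joint_events_measurable); exact: h.
Qed.

(** [orthogonal] is used twice: it replaces [g] by an indicator, and then, with [f] as the weight
    and the centred indicator as the integrand, it replaces [f] by an indicator; the product rule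
    for events remains. *)
Lemma indep_orthogonal i f g : ~~ J i ->
  (forall B, measurable B -> sigma_gen (F i) (f @^-1` B)) -> gen_measurable joint_events g ->
  integrable1 f -> integrable1 (fun w => g w * f w) -> Ex f = 0 ->
  Ex (fun w => g w * f w) = 0.
Proof.
move=> Ji sf sg if_ igf f0; have mg := joint_gen_measurable sg.
apply: orthogonal => // B mB.
pose B' := g @^-1` B.
have sB' : <<s joint_events >> B' by exact: (gen_measurableP _ _).1.
have mB' : measurable B' by rewrite -[B']setTI; exact: mg.
have mf : measurable_fun setT f by apply/measurable_EFinP; exact: measurable_int if_.
pose pB := fine (P B').
have i1 : integrable1 \1_B'.
  apply: (@integrable_dominated _ _ _ _ _ (fun=> 1)) => //.
    by move=> w; rewrite indicE; case: (_ \in _); rewrite ?normr1 ?normr0.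
  exact: integrable_constant.
have ih : integrable1 (fun w => \1_B' w - pB).
  apply: integrable_addr => //; exact: integrable_constant.
have i1f : integrable1 (fun w => \1_B' w * f w) by exact: integrable_indic_mul.
(* As [f] has mean zero, the indicator may be centred at no cost. *)
have e1 : Ex (fun w => f w * (\1_B' w - pB)) = Ex (fun w => \1_B' w * f w).
  rewrite (_ : (fun w => f w * _) = fun w => \1_B' w * f w - pB * f w).
    rewrite RintegralB//; last exact: integrable_scale.
    by rewrite RintegralZl// f0 mulr0 subr0.
  by apply/funext => w; ring.
rewrite -[LHS]/(Ex (fun w => \1_B' w * f w)) -e1; apply: orthogonal => //.
  rewrite (_ : (fun w => f w * _) = fun w => \1_B' w * f w + - pB * f w).
    by apply: integrable_addr => //; exact: integrable_scale.
  by apply/funext => w; ring.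
move=> C mC; pose C' := f @^-1` C.
have mC' : measurable C' by rewrite -[C']setTI; exact: mf.
rewrite -[LHS]/(Ex (fun w => \1_C' w * (\1_B' w - pB))).
rewrite (_ : (fun w => _) = fun w => \1_(C' `&` B') w - pB * \1_C' w).
  have i2 (A : set Om) : measurable A -> integrable1 \1_A.
    move=> mA; apply: (@integrable_dominated _ _ _ _ _ (fun=> 1)) => //.
      by move=> w; rewrite indicE; case: (_ \in _); rewrite ?normr1 ?normr0.
    exact: integrable_constant.
  rewrite RintegralB//; [|exact: i2 (measurableI _ _ _ _)|apply: integrable_scale; exact: i2].
  rewrite RintegralZl//; last exact: i2.
  rewrite !Ex_indic//; last exact: measurableI.
  rewrite (indep_joint_events Ji (sf _ mC) sB') fineM ?fin_num_measure//.
  by rewrite mulrC subrr.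
by apply/funext => w; rewrite indicI /=; ring.
Qed.
End Independence.
End Orthogonality.

(** * Sub-Gaussian tails *)

Lemma ler_pow_base (R : realType) (x y : R) n : 0 <= x -> x <= y -> x ^+ n <= y ^+ n.
Proof. by move=> x0 xy; rewrite lerXn2r// nnegrE (le_trans x0). Qed.

Section SubGaussian.
Context d (Om : measurableType d) (R : realType) (P : probability Om R).
Implicit Types (X Y Z : Om -> R).
Local Notation Ex := (Rintegral P setT).
Local Notation integrable1 f := (P.-integrable setT (EFin \o f)).

(* [e^(y/2) <= sum_n e^((n+1)/2) 1_{n <= y}] for [y >= 0], and the tail bound turns the
   expectation of the right-hand side at [y = C X^2] into a geometric series. *)
Definition exp_moment (K : R) : R := 1 + 2^-1 * K * expR (2^-1) * (1 - expR (- 2^-1))^-1.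

Lemma exp_moment_ge1 (K : R) : 0 < K -> 1 <= exp_moment K.
Proof.
move=> K0; have h : 0 <= (1 - expR (- 2^-1) : R)^-1.
  by rewrite invr_ge0 subr_ge0 -[leRHS]expR0 ler_expR oppr_le0.
by rewrite /exp_moment lerDl !mulr_ge0 ?expR_ge0// ltW.
Qed.

Lemma subgaussian_exp_moment X (C K : R) : 0 < C -> 0 < K -> measurable_fun setT X ->
  (forall e : R, 0 <= e ->
    (P [set w | (e <= `|X w|)%R] <= (2^-1 * K * expR (- C * e ^+ 2))%:E)%E) ->
  integrable1 (fun w => expR (C * X w ^+ 2 / 2)) /\
  Ex (fun w => expR (C * X w ^+ 2 / 2)) <= exp_moment K.
Proof.
move=> C0 K0 mX tailX.
pose Y w := C * X w ^+ 2.
have Y0 w : 0 <= Y w by rewrite mulr_ge0 ?sqr_ge0 ?ltW.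
pose A (n : nat) := [set w | Num.sqrt (n%:R / C) <= `|X w|].
have mA n : measurable (A n) by exact: measurable_abs_ge.
have AY n w : A n w <-> n%:R <= Y w.
  have nC : 0 <= n%:R / C by rewrite divr_ge0// ltW.
  rewrite /A /= -(ler_sqr (x := Num.sqrt _)) ?nnegrE ?sqrtr_ge0//.
  by rewrite sqr_sqrtr// real_normK ?num_real// ler_pdivrMr// mulrC.
pose f (n : nat) (w : Om) : \bar R := (expR ((n%:R + 1) / 2) * \1_(A n) w)%:E.
have f0 n w : (0 <= f n w)%E by rewrite lee_fin mulr_ge0 ?expR_ge0.
have mf n : measurable_fun setT (f n).
  by apply/measurable_EFinP; apply: measurable_funM.
have le_f w : ((expR (Y w / 2))%:E <= \sum_(0 <= n <oo) f n w)%E.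
  (* The single summand whose index is the integer part of [Y w] already dominates. *)
  have /andP[h1 h2] := truncn_itv (Y0 w); set n := Num.truncn _ in h1 h2.
  apply: le_trans (nneseries_lim_ge n.+1 _); last by move=> i _ _.
  rewrite big_nat_recr//=; apply: (@le_trans _ _ (f n w)).
    rewrite /f lee_fin indicE mem_set ?mulr1 ?ler_expR; last exact/AY.
    by rewrite ler_pM2r ?invr_gt0// -natr1 in h2 *; exact: ltW.
  by rewrite leeDr// sume_ge0.
(* At threshold [sqrt (n / C)] the tail is at most [K/2 exp (- n)]; against the weight
   [exp ((n + 1) / 2)] a geometric ratio [exp (- 1/2)] is left. *)
have If n : (\int[P]_w f n w <= (2^-1 * K * expR (2^-1) * expR (- 2^-1) ^+ n)%:E)%E.
  rewrite /f; under eq_integral do rewrite EFinM.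
  rewrite ge0_integralZl_EFin ?expR_ge0//; last exact/measurable_EFinP.
  rewrite integral_indic// setIT.
  apply: le_trans (lee_pmul _ _ (lexx _) (tailX _ (sqrtr_ge0 _))) _.
  - by rewrite lee_fin expR_ge0.
  - exact: measure_ge0.
  have nC : 0 <= n%:R / C by rewrite divr_ge0// ltW.
  rewrite -EFinM lee_fin sqr_sqrtr//.
  rewrite -expRM_natr mulrCA -expRD -[leRHS]mulrA -expRD le_eqVlt.
  by apply/orP; left; apply/eqP; congr (_ * expR _); field; rewrite gt_eqF.
have intf : (\int[P]_w \sum_(0 <= n <oo) f n w <= (exp_moment K - 1)%:E)%E.
  rewrite integral_nneseries//.
  apply: lime_le.
    by apply: is_cvg_nneseries => n _ _; exact: integral_ge0.
  apply: nearW => n; apply: le_trans (lee_sum _ (fun i _ => If i)) _.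
  rewrite sumEFin lee_fin -mulr_sumr /exp_moment addrAC subrr add0r.
  apply: ler_wpM2l; first by rewrite !mulr_ge0 ?expR_ge0// ltW.
  set x := expR _; have x1 : x < 1 by rewrite -[ltRHS]expR0 ltr_expR oppr_lt0.
  have x0 : 0 <= x by exact: expR_ge0.
  rewrite big_mkord -[leRHS]mul1r ler_pdivlMr ?subr_gt0// mulrC -opprB mulNr -subrX1.
  by rewrite opprB gerBl exprn_ge0.
have mE : measurable_fun setT (fun w => expR (C * X w ^+ 2 / 2)).
  apply: measurableT_comp => //; apply: measurable_funM => //.
  by apply: measurable_funM => //; exact: measurable_funX.
have intE : (\int[P]_w (expR (C * X w ^+ 2 / 2))%:E <= (exp_moment K)%:E)%E.
  apply: (@le_trans _ _ (\int[P]_w \sum_(0 <= n <oo) f n w)%E).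
    apply: ge0_le_integral => //.
    - exact/measurable_EFinP.
    - exact: ge0_emeasurable_sum.
    - by move=> w _; exact: le_f.
  by apply: le_trans intf _; rewrite lee_fin gerBl.
have iE : integrable1 (fun w => expR (C * X w ^+ 2 / 2)).
  apply/integrableP; split; first exact/measurable_EFinP.
  apply: le_lt_trans (ltry (exp_moment K)).
  by under eq_integral do rewrite gee0_abs ?lee_fin ?expR_ge0//.
by split=> //; rewrite -lee_fin fineK//; exact: integrable_fin_num.
Qed.

(** With [z = C X^2 / (2k)], [X^(2k)] is [(2k / C)^k z^k], and [z <= exp z] turns [z^k] into at most
    [exp (C X^2 / 2)]. *)
Lemma subgaussian_moments X (C K : R) : 0 < C -> 0 < K -> measurable_fun setT X ->
  (forall e : R, 0 <= e ->
    (P [set w | (e <= `|X w|)%R] <= (2^-1 * K * expR (- C * e ^+ 2))%:E)%E) ->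
  all_moments P X /\
  forall k, (0 < k)%N -> Ex (fun w => X w ^+ k.*2) <= exp_moment K * (2 / C * k%:R) ^+ k.
Proof.
move=> C0 K0 mX tailX; have [iE EE] := subgaussian_exp_moment C0 K0 mX tailX.
have bnd k w : (0 < k)%N ->
    X w ^+ k.*2 <= (2 / C * k%:R) ^+ k * expR (C * X w ^+ 2 / 2).
  move=> k0; have kR : 0 < k%:R :> R by rewrite ltr0n.
  set e := expR _; have -> : X w ^+ k.*2 = (2 / C * k%:R) ^+ k * (C * X w ^+ 2 / 2 / k%:R) ^+ k.
    by rewrite -exprMn -mul2n exprM; congr (_ ^+ _); field; rewrite !gt_eqF.
  have p0 : 0 <= 2 / C * k%:R by rewrite mulr_ge0// divr_ge0// ltW.
  apply: ler_wpM2l; first by rewrite exprn_ge0.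
  have -> : e = expR (C * X w ^+ 2 / 2 / k%:R) ^+ k.
    by rewrite -expRM_natr divfK// gt_eqF.
  have h0 : 0 <= C * X w ^+ 2 / 2 / k%:R by rewrite divr_ge0// divr_ge0// mulr_ge0 ?sqr_ge0// ltW.
  rewrite lerXn2r// ?nnegrE ?expR_ge0//.
  by apply: le_trans (expR_ge1Dx _); rewrite lerDr.
have iX k : (0 < k)%N -> integrable1 (fun w => X w ^+ k.*2).
  move=> k0; apply: (@integrable_dominated _ _ _ _ _
      (fun w => (2 / C * k%:R) ^+ k * expR (C * X w ^+ 2 / 2))).
  - exact: measurable_funX.
  - by move=> w; rewrite ger0_norm ?even_pow_ge0// bnd.
  - exact: integrable_scale.
split.
  apply: all_moments_even => // -[|k]; last exact: iX.
  exact: integrable_constant.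
move=> k k0.
have p0 : 0 <= 2 / C * k%:R by rewrite mulr_ge0// divr_ge0// ltW.
apply: (@le_trans _ _ (Ex (fun w => (2 / C * k%:R) ^+ k * expR (C * X w ^+ 2 / 2)))).
  apply: le_Rintegral => //; [exact: iX|exact: integrable_scale|].
  by move=> w _; exact: bnd.
by rewrite RintegralZl// [leRHS]mulrC; apply: ler_wpM2l => //; rewrite exprn_ge0.
Qed.

(* Products of two sub-Gaussian variables have this moment growth. *)
Definition subexponential (c : R) X :=
  all_moments P X /\ forall k, (0 < k)%N -> Ex (fun w => X w ^+ k.*2) <= (c * k%:R ^+ 2) ^+ k.

(** One constant for two uses: [16 / C^2] comes from products, where the order doubles, and [2 / C]
    from single variables. The prefactor is at least 1, so it may be raised to the power [k]. *)
Definition subexp_const (C K : R) : R := exp_moment K * (16 / C ^+ 2 + 2 / C).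

Lemma subexponential_subgaussian X (C K : R) : 0 < C -> 0 < K -> measurable_fun setT X ->
  (forall e : R, 0 <= e ->
    (P [set w | (e <= `|X w|)%R] <= (2^-1 * K * expR (- C * e ^+ 2))%:E)%E) ->
  subexponential (subexp_const C K) X.
Proof.
move=> C0 K0 mX tailX; have [aX bX] := subgaussian_moments C0 K0 mX tailX.
split=> // k k0; apply: le_trans (bX k k0) _.
have e1 := exp_moment_ge1 K0.
have kR : 1 <= k%:R :> R by rewrite ler1n.
apply: (@le_trans _ _ (exp_moment K ^+ k * (2 / C * k%:R) ^+ k)).
  have p0 : 0 <= 2 / C * k%:R by rewrite mulr_ge0// divr_ge0// ltW.
  by apply: ler_wpM2r; rewrite ?exprn_ge0// -[leLHS]expr1 ler_weXn2l.
have c1 : 0 <= 2 / C by rewrite divr_ge0// ltW.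
have c2 : 0 <= 16 / C ^+ 2 by rewrite divr_ge0// sqr_ge0.
have e0 : 0 <= exp_moment K by apply: le_trans e1.
rewrite -exprMn; apply: ler_pow_base; first by apply: mulr_ge0 => //; exact: mulr_ge0.
rewrite /subexp_const -[X in _ <= X]mulrA; apply: ler_wpM2l => //.
apply: (@le_trans _ _ (2 / C * k%:R ^+ 2)).
  by apply: ler_wpM2l => //; rewrite expr2; nra.
by apply: ler_wpM2r; rewrite ?sqr_ge0// lerDr.
Qed.

(** [(x y)^(2k) <= (x^(4k) + y^(4k)) / 2]; the sub-Gaussian moments of order [4k] give the growth
    [k^(2k)]. *)
Lemma subexponential_mul X Y (C K : R) : 0 < C -> 0 < K ->
  measurable_fun setT X -> measurable_fun setT Y ->
  (forall e : R, 0 <= e ->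
    (P [set w | (e <= `|X w|)%R] <= (2^-1 * K * expR (- C * e ^+ 2))%:E)%E) ->
  (forall e : R, 0 <= e ->
    (P [set w | (e <= `|Y w|)%R] <= (2^-1 * K * expR (- C * e ^+ 2))%:E)%E) ->
  subexponential (subexp_const C K) (fun w => X w * Y w).
Proof.
move=> C0 K0 mX mY tX tY.
have [aX bX] := subgaussian_moments C0 K0 mX tX.
have [aY bY] := subgaussian_moments C0 K0 mY tY.
have aXY := all_moments_M aX aY.
split=> // k k0; have kk0 : (0 < k.*2)%N by rewrite double_gt0.
have e1 := exp_moment_ge1 K0.
have e0 : 0 <= exp_moment K by apply: le_trans e1.
have kR : 1 <= k%:R :> R by rewrite ler1n.
have iX : integrable1 (fun w => X w ^+ k.*2.*2) by case: aX.
have iY : integrable1 (fun w => Y w ^+ k.*2.*2) by case: aY.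
apply: (@le_trans _ _ (Ex (fun w => 2^-1 * X w ^+ k.*2.*2 + 2^-1 * Y w ^+ k.*2.*2))).
  apply: le_Rintegral => //.
  - by case: aXY.
  - by apply: integrable_addr; exact: integrable_scale.
  - move=> w _; rewrite exprMn -!muln2 !exprM; set x := X w ^+ _; set y := Y w ^+ _.
    by have := sqr_ge0 (x ^+ 2 - y ^+ 2); nra.
rewrite (RintegralD _ (integrable_scale _ iX) (integrable_scale _ iY))//.
rewrite !RintegralZl//.
have := bX _ kk0; have := bY _ kk0; set B := exp_moment K * _ => b1 b2.
apply: (@le_trans _ _ B); first by lra.
have c1 : 0 <= 2 / C by rewrite divr_ge0// ltW.
have c2 : 0 <= 16 / C ^+ 2 by rewrite divr_ge0// sqr_ge0.
apply: (@le_trans _ _ (exp_moment K ^+ k * (2 / C * k.*2%:R) ^+ k.*2)).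
  have p0 : 0 <= 2 / C * k.*2%:R by rewrite mulr_ge0.
  by apply: ler_wpM2r; rewrite ?exprn_ge0// -[leLHS]expr1 ler_weXn2l.
have -> : (2 / C * k.*2%:R) ^+ k.*2 = ((2 / C * k.*2%:R) ^+ 2) ^+ k by rewrite -exprM mul2n.
rewrite -exprMn; apply: ler_pow_base.
  by apply: mulr_ge0 => //; exact: sqr_ge0.
rewrite /subexp_const -[X in _ <= X]mulrA; apply: ler_wpM2l => //.
have -> : (2 / C * k.*2%:R) ^+ 2 = 16 / C ^+ 2 * k%:R ^+ 2.
  by rewrite -mul2n natrM; field; rewrite gt_eqF.
by apply: ler_wpM2r; rewrite ?sqr_ge0// lerDl.
Qed.
End SubGaussian.

(** * The oracle inequality *)

Section Deterministic.
Context {R : realType}.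

(** Thresholding at [r]: each large entry contributes at least [r^nu] to the sum, and a small one
    satisfies [|x| = |x|^nu |x|^(1-nu) <= |x|^nu r^(1-nu)]. *)
Lemma sparse_tail (I : finType) (eta : I -> R) (r nu E : R) :
  0 < r -> 0 < nu < 1 -> \sum_i `|eta i| `^ nu <= E ->
  #|[set i | r < `|eta i|]%SET|%:R <= E * r `^ (- nu) /\
  \sum_(i | i \notin [set i | r < `|eta i|]%SET) `|eta i| <= E * r `^ (1 - nu).
Proof.
move=> r0 /andP[nu0 nu1] hE; set J := [set i | _]%SET.
have rnu : 0 < r `^ nu by exact: powR_gt0.
have rE : r `^ (- nu) = (r `^ nu)^-1 by rewrite powRN.
split.
  rewrite rE ler_pdivlMr// (le_trans _ hE)//.
  rewrite (bigID (mem J))/= -[leLHS]addr0; apply: lerD; last first.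
    by apply: sumr_ge0 => i _; exact: powR_ge0.
  rewrite mulr_natl -sumr_const; apply: ler_sum => i; rewrite inE => ri.
  by apply: ge0_ler_powR; rewrite ?nnegrE//; exact: ltW.
apply: le_trans (_ : (\sum_(i | i \notin J) `|eta i| `^ nu) * r `^ (1 - nu) <= _).
  rewrite mulr_suml; apply: ler_sum => i; rewrite inE -leNgt => ir.
  have [->|e0] := eqVneq (eta i) 0; first by rewrite normr0 mulr_ge0// powR_ge0.
  have e1 : 0 < `|eta i| by rewrite normr_gt0.
  apply: (@le_trans _ _ (`|eta i| `^ nu * `|eta i| `^ (1 - nu))).
    rewrite -powRD; last by apply/implyP => _; rewrite gt_eqF.
    by rewrite (_ : nu + (1 - nu) = 1) ?powRr1//; ring.
  apply: ler_wpM2l; first exact: powR_ge0.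
  by apply: ge0_ler_powR; rewrite ?nnegrE ?subr_ge0//; exact: ltW.
rewrite ler_wpM2r ?powR_ge0// (le_trans _ hE)//.
by rewrite [leRHS](bigID (mem J))/= lerDr; apply: sumr_ge0 => i _; exact: powR_ge0.
Qed.

(** Triangle inequality, used as [|b| - |a| <= |a - b|] on [J] and as [|a - b| <= |a| + |b|] off it.
    Here [a] is the estimate, [b] the truth and [J] its large entries. *)
Lemma l1_increment (I : finType) (a b : I -> R) (J : {set I}) :
  \sum_i (`|a i - b i| + `|b i| - `|a i|)
    <= 2 * \sum_(i in J) `|a i - b i| + 2 * \sum_(i | i \notin J) `|b i|.
Proof.
rewrite (bigID (mem J))/=; apply: lerD; rewrite mulr_sumr; apply: ler_sum => i _.
  by have := lerB_dist (b i) (a i); rewrite distrC; lra.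
by have := ler_normB (a i) (b i); lra.
Qed.

Lemma sum_norm_le (I : finType) (u v : I -> R) c : (forall i, `|v i| <= c) ->
  `|\sum_i u i * v i| <= c * \sum_i `|u i|.
Proof.
move=> h; apply: le_trans (ler_norm_sum _ _ _) _; rewrite mulr_sumr.
by apply: ler_sum => i _; rewrite normrM mulrC ler_wpM2r.
Qed.

Lemma cauchy_schwarz_card (I : finType) (J : {set I}) (u : I -> R) :
  (\sum_(i in J) `|u i|) ^+ 2 <= #|J|%:R * \sum_(i in J) u i ^+ 2.
Proof.
rewrite expr2 big_distrlr /=.
apply: le_trans (_ : \sum_(i in J) \sum_(j in J) (2^-1 * (u i ^+ 2 + u j ^+ 2)) <= _).
  apply: ler_sum => i _; apply: ler_sum => j _.
  rewrite -(real_normK (num_real (u i))) -(real_normK (num_real (u j))).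
  by have := sqr_ge0 (`|u i| - `|u j|); nra.
set s := \sum_(i in J) u i ^+ 2; rewrite le_eqVlt; apply/orP; left; apply/eqP.
transitivity (\sum_(i in J) 2^-1 * (#|J|%:R * u i ^+ 2 + s)).
  by apply: eq_bigr => i _; rewrite -mulr_sumr big_split/= sumr_const mulr_natl.
rewrite -mulr_sumr big_split/= sumr_const -mulr_sumr -/s -[s *+ _]mulr_natl.
by field.
Qed.

(** * Deterministic error bound for the rescaled problem *)

Section Oracle.
Context (N T p : nat) (z : 'I_N -> 'I_T -> 'I_p -> R) (eps : 'I_N -> 'I_T -> R).
Context (alpha a : 'I_p -> R) (eta h : 'I_N -> R) (Psi : 'I_p -> 'I_p -> R).
Context (lam sN Delta k2 S e : R) (J1 : {set 'I_p}) (J2 : {set 'I_N}) (b2 : 'I_N -> R).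
Hypotheses (T_gt0 : (0 < T)%N) (sN0 : 0 < sN) (sN2 : sN ^+ 2 = N%:R) (lam0 : 0 < lam).
(** Rescaling the error in the fixed effects by [sN = sqrt N] gives it the penalty weight [lam] and
    turns the normalised Gram block of the dummies into the identity. *)
Hypothesis hb2 : forall i, h i - eta i = sN * b2 i.
Let d l := a l - alpha l.
Let fit i t := \sum_l z i t l * d l + (h i - eta i).

Hypothesis lasso :
  \sum_i \sum_t (eps i t - fit i t) ^+ 2 + 2 * lam * \sum_l `|a l|
    + 2 * (lam / sN) * \sum_i `|h i|
  <= \sum_i \sum_t eps i t ^+ 2 + 2 * lam * \sum_l `|alpha l|
    + 2 * (lam / sN) * \sum_i `|eta i|.
Hypothesis noiseZ : forall l, `|\sum_i \sum_t z i t l * eps i t| <= lam / 2.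
Hypothesis noiseD : forall i, `|\sum_t eps i t| <= lam / sN / 2.
Hypothesis suppJ1 : forall l, l \notin J1 -> alpha l = 0.
Hypothesis tailJ2 : (\sum_(i | i \notin J2) `|eta i|) / sN <= e.

Let B := \sum_l `|d l| + \sum_i `|b2 i|.
Let X := \sum_(l in J1) `|d l| + \sum_(i in J2) `|b2 i|.
Let Q := \sum_i \sum_t fit i t ^+ 2.

Lemma noise_expand : \sum_i \sum_t eps i t * fit i t =
  \sum_l d l * (\sum_i \sum_t z i t l * eps i t) + \sum_i (h i - eta i) * \sum_t eps i t.
Proof.
transitivity (\sum_i (\sum_l d l * (\sum_t z i t l * eps i t) +
   (h i - eta i) * \sum_t eps i t)).
  apply: eq_bigr => i _; rewrite mulr_sumr.
  under [X in _ = X + _]eq_bigr do rewrite mulr_sumr.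
  rewrite [X in _ = X + _]exchange_big -big_split /=; apply: eq_bigr => t _.
  rewrite /fit mulrDr mulr_sumr; congr (_ + _); last by rewrite mulrC.
  by apply: eq_bigr => l _; ring.
rewrite big_split /=; congr (_ + _); rewrite exchange_big /=.
by apply: eq_bigr => l _; rewrite mulr_sumr.
Qed.

(** The noise bounds are half the penalty levels, so twice the noise term is at most [lam * B].
    Adding [lam * B] on both sides completes the penalty differences to the form of
    [l1_increment]. *)
Lemma basic_inequality : Q + lam * B <= 4 * lam * X + 4 * lam * e.
Proof.
have sqE : \sum_i \sum_t (eps i t - fit i t) ^+ 2 =
    \sum_i \sum_t eps i t ^+ 2 - 2 * (\sum_i \sum_t eps i t * fit i t) + Q.
  rewrite /Q mulr_sumr -sumrB -big_split; apply: eq_bigr => i _ /=.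
  rewrite mulr_sumr -sumrB -big_split; apply: eq_bigr => t _ /=; ring.
have hn : \sum_i \sum_t eps i t * fit i t <=
    lam / 2 * \sum_l `|d l| + lam / sN / 2 * \sum_i `|h i - eta i|.
  rewrite noise_expand; apply: lerD.
    exact: le_trans (ler_norm _) (sum_norm_le _ noiseZ).
  exact: le_trans (ler_norm _) (sum_norm_le _ noiseD).
have e2 : \sum_i `|h i - eta i| = sN * \sum_i `|b2 i|.
  by rewrite mulr_sumr; apply: eq_bigr => i _; rewrite hb2 normrM gtr0_norm.
have e2J : \sum_(i in J2) `|h i - eta i| = sN * \sum_(i in J2) `|b2 i|.
  by rewrite mulr_sumr; apply: eq_bigr => i _; rewrite hb2 normrM gtr0_norm.
have l1 := l1_increment a alpha J1; have l2 := l1_increment h eta J2.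
have s0 : \sum_(l | l \notin J1) `|alpha l| = 0.
  by apply: big1 => l /suppJ1 ->; rewrite normr0.
rewrite s0 mulr0 addr0 sumrB big_split /= in l1.
rewrite sumrB big_split /= e2 e2J in l2.
rewrite e2 in hn; have L := lasso; rewrite sqE in L.
have {}hn : \sum_i \sum_t eps i t * fit i t <=
    lam / 2 * \sum_l `|d l| + lam / 2 * \sum_i `|b2 i|.
  apply: le_trans hn _; rewrite le_eqVlt; apply/orP; left; apply/eqP.
  by field; rewrite gt_eqF.
have e3 : \sum_(i | i \notin J2) `|eta i| <= sN * e by rewrite mulrC -ler_pdivrMr.
have {}l2 : \sum_i `|eta i| - \sum_i `|h i| <= sN * (2 * \sum_(i in J2) `|b2 i| + 2 * e - \sum_i `|b2 i|).
  by lra.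
have c0 : 0 < lam / sN by rewrite divr_gt0.
have {}l2 := ler_wpM2l (ltW c0) l2; rewrite mulrA divfK ?gt_eqF// in l2.
have {}l1 := ler_wpM2l (ltW lam0) l1.
rewrite -/d in l1; rewrite /B /X.
move: L hn l1 l2; set u := \sum_i \sum_t eps i t ^+ 2.
move: (lam / sN) (\sum_i `|eta i|) (\sum_i `|h i|) => c A1 A2; lra.
Qed.

Hypothesis Delta0 : 0 <= Delta.
Hypothesis gramZ : forall l m,
  `|(N%:R * T%:R)^-1 * (\sum_i \sum_t z i t l * z i t m) - Psi l m| <= Delta.
Hypothesis gramD : forall i l, `|T%:R^-1 * \sum_t z i t l| <= Delta * sN.
Hypothesis k2_gt0 : 0 < k2.
Hypothesis k2_le1 : k2 <= 1.
Hypothesis re : k2 * \sum_(l in J1) d l ^+ 2 <= \sum_l \sum_m d l * Psi l m * d m.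

Lemma quadratic_expand : (N%:R * T%:R)^-1 * Q =
  \sum_l d l * (\sum_m d m * ((N%:R * T%:R)^-1 * (\sum_i \sum_t z i t l * z i t m)))
  + 2 * (\sum_i b2 i * (\sum_l d l * (sN^-1 * (T%:R^-1 * \sum_t z i t l))))
  + \sum_i b2 i ^+ 2.
Proof.
have N0 : N%:R != 0 :> R by rewrite -sN2 gt_eqF// exprn_gt0.
have T0 : T%:R != 0 :> R by rewrite pnatr_eq0 -lt0n.
have -> : Q = \sum_i \sum_t (\sum_l z i t l * d l) ^+ 2
   + (2 * \sum_i sN * b2 i * (\sum_l d l * \sum_t z i t l)
   + T%:R * N%:R * \sum_i b2 i ^+ 2).
  rewrite !mulr_sumr -!big_split /=; apply: eq_bigr => i _.
  have -> : \sum_l d l * (\sum_t z i t l) = \sum_t \sum_l z i t l * d l.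
    by rewrite exchange_big; apply: eq_bigr => l _; rewrite mulrC mulr_suml.
  have -> : T%:R * N%:R * b2 i ^+ 2 = \sum_(t < T) N%:R * b2 i ^+ 2.
    by rewrite sumr_const card_ord -[RHS]mulr_natl mulrA.
  rewrite !mulr_sumr -!big_split; apply: eq_bigr => t _ /=.
  by rewrite /fit hb2 -sN2; ring.
have -> : \sum_i \sum_t (\sum_l z i t l * d l) ^+ 2 =
    \sum_l d l * (\sum_m d m * (\sum_i \sum_t z i t l * z i t m)).
  under eq_bigr do under eq_bigr do rewrite expr2 big_distrlr /=.
  under eq_bigr do rewrite exchange_big /=.
  rewrite exchange_big /=; apply: eq_bigr => l _.
  under eq_bigr do rewrite exchange_big /=.
  rewrite exchange_big mulr_sumr /=; apply: eq_bigr => m _.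
  rewrite !mulr_sumr; apply: eq_bigr => i _; rewrite !mulr_sumr; apply: eq_bigr => t _; ring.
rewrite !mulrDr addrA; congr (_ + _ + _).
- rewrite mulr_sumr; apply: eq_bigr => l _; rewrite mulrCA; congr (_ * _).
  by rewrite mulr_sumr; apply: eq_bigr => m _; rewrite mulrCA.
- rewrite mulrCA; congr (_ * _); rewrite mulr_sumr; apply: eq_bigr => i _.
  have gen (W : 'I_p -> R) : (N%:R * T%:R)^-1 * (sN * b2 i * \sum_l d l * W l) =
      b2 i * \sum_l d l * (sN^-1 * (T%:R^-1 * W l)).
    rewrite !mulr_sumr; apply: eq_bigr => l _; rewrite -sN2; field.
    by rewrite T0 gt_eqF.
  exact: (gen (fun l => \sum_t z i t l)).
- by rewrite [T%:R * _]mulrC mulKf// mulf_neq0.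
Qed.

(** The comparison matrix is block diagonal with blocks [Psi] and identity; an entrywise error
    [Delta] costs at most [Delta * B ^+ 2]. The bound [k2 <= 1] lets the identity block share the
    constant of [Psi]. *)
Lemma restricted_eigenvalue :
  k2 * (\sum_(l in J1) d l ^+ 2 + \sum_(i in J2) b2 i ^+ 2) - Delta * B ^+ 2
    <= (N%:R * T%:R)^-1 * Q.
Proof.
rewrite quadratic_expand.
set G := fun l m => (N%:R * T%:R)^-1 * (\sum_i \sum_t z i t l * z i t m).
set D1 := \sum_l `|d l|; set D2 := \sum_i `|b2 i|.
have D10 : 0 <= D1 by exact: sumr_ge0. have D20 : 0 <= D2 by exact: sumr_ge0.
have h1 : \sum_l \sum_m d l * Psi l m * d m - Delta * D1 * D1 <=
    \sum_l d l * \sum_m d m * G l m.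
  have -> : \sum_l d l * \sum_m d m * G l m = \sum_l \sum_m d l * Psi l m * d m
     + \sum_l d l * \sum_m d m * (G l m - Psi l m).
    rewrite -big_split; apply: eq_bigr => l _ /=; rewrite !mulr_sumr -big_split.
    by apply: eq_bigr => m _ /=; ring.
  have : `|\sum_l d l * \sum_m d m * (G l m - Psi l m)| <= Delta * D1 * D1.
    by apply: sum_norm_le => l; apply: sum_norm_le => m; exact: gramZ.
  by rewrite ler_norml => /andP[]; lra.
have h2 : `|\sum_i b2 i * \sum_l d l * (sN^-1 * (T%:R^-1 * \sum_t z i t l))| <= Delta * D1 * D2.
  apply: sum_norm_le => i; apply: sum_norm_le => l.
  by rewrite normrM gtr0_norm ?invr_gt0// mulrC ler_pdivrMr.
have h3 : k2 * \sum_(i in J2) b2 i ^+ 2 <= \sum_i b2 i ^+ 2.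
  apply: (@le_trans _ _ (\sum_(i in J2) b2 i ^+ 2)).
    by rewrite -[leRHS]mul1r ler_wpM2r//; apply: sumr_ge0 => i _; exact: sqr_ge0.
  by rewrite [leRHS](bigID (mem J2))/= lerDl; apply: sumr_ge0 => i _; exact: sqr_ge0.
move: h2; rewrite ler_norml => /andP[h2 _].
rewrite /B -/D1 -/D2.
have D2sq : 0 <= Delta * D2 ^+ 2 by rewrite mulr_ge0// sqr_ge0.
move: h1 h2 h3 (re); set q1 := \sum_l d l * _; set q2 := \sum_i b2 i * _; nra.
Qed.

Hypothesis cardJ : #|J1|%:R + #|J2|%:R <= S.
Hypothesis S_gt0 : 0 < S.
Hypothesis e_ge0 : 0 <= e.
Hypothesis DeltaE : Delta = k2 / (50 * S).
Hypothesis N_gt0 : (0 < N)%N.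

(** If [X <= 4 * e], the basic inequality gives [20 * l * e]. Otherwise the tail is absorbed and the
    error lies in the cone [B <= 5 * X]; the quadratic lower bound then forces
    [X <= 10 * l * S / k2], which contributes [50 / k2 * l ^+ 2 * S]. *)
Lemma oracle_bound (l : R) : l = lam / (N%:R * T%:R) ->
  (N%:R * T%:R)^-1 * Q + l * B <= 120 / k2 * l ^+ 2 * S + 20 * l * e.
Proof.
move=> lE; have NT0 : 0 < N%:R * T%:R :> R by rewrite mulr_gt0// ltr0n.
have l0 : 0 < l by rewrite lE divr_gt0.
have X0 : 0 <= X by rewrite addr_ge0 ?sumr_ge0.
have bi : (N%:R * T%:R)^-1 * Q + l * B <= 4 * l * X + 4 * l * e.
  have i0 : 0 <= (N%:R * T%:R)^-1 :> R by rewrite invr_ge0 ltW.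
  have := ler_wpM2l i0 basic_inequality.
  by rewrite lE; move: (N%:R * T%:R)^-1 => i; lra.
have Q0 : 0 <= (N%:R * T%:R)^-1 * Q.
  rewrite mulr_ge0 ?invr_ge0 ?(ltW NT0)//.
  by apply: sumr_ge0 => i _; apply: sumr_ge0 => t _; exact: sqr_ge0.
have t0 : 0 <= 120 / k2 * l ^+ 2 * S.
  by rewrite mulr_ge0 ?(ltW S_gt0)// mulr_ge0 ?sqr_ge0// divr_ge0// ltW.
have [Xe|Xe] := leP X (4 * e).
  apply: le_trans bi _; have := ler_wpM2l (ltW l0) Xe; lra.
have Xp : 0 < X by apply: le_lt_trans Xe; rewrite mulr_ge0.
have B0 : 0 <= B by rewrite addr_ge0 ?sumr_ge0.
have bi5 : (N%:R * T%:R)^-1 * Q + l * B <= 5 * l * X.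
  apply: le_trans bi _; have := ler_wpM2l (ltW l0) (ltW Xe); lra.
have BX : B <= 5 * X.
  by rewrite -(ler_pM2l l0); lra.
set n2 := \sum_(l in J1) d l ^+ 2 + \sum_(i in J2) b2 i ^+ 2.
have X2 : X ^+ 2 <= S * n2.
  set u1 := \sum_(l in J1) d l ^+ 2; set u2 := \sum_(i in J2) b2 i ^+ 2.
  have c1 := cauchy_schwarz_card J1 d; have c2 := cauchy_schwarz_card J2 b2.
  rewrite -/u1 in c1; rewrite -/u2 in c2; rewrite /n2 -/u1 -/u2 /X.
  have u10 : 0 <= u1 by apply: sumr_ge0 => i _; exact: sqr_ge0.
  have u20 : 0 <= u2 by apply: sumr_ge0 => i _; exact: sqr_ge0.
  set x1 := \sum_(l in J1) _ in c1 *; set x2 := \sum_(i in J2) _ in c2 *.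
  have x10 : 0 <= x1 by exact: sumr_ge0. have x20 : 0 <= x2 by exact: sumr_ge0.
  set n1 : R := #|J1|%:R in c1 *; set m1 : R := #|J2|%:R in c2 *.
  have n10 : 0 <= n1 by []. have m10 : 0 <= m1 by [].
  apply: (@le_trans _ _ ((n1 + m1) * (u1 + u2))); last first.
    by apply: ler_wpM2r => //; exact: addr_ge0.
  (* The two Cauchy-Schwarz bounds multiplied; the arithmetic-geometric mean inequality then handles
     the cross term of [(x1 + x2) ^+ 2]. *)
  have key : (x1 * x2) ^+ 2 <= (n1 * u2) * (m1 * u1).
    rewrite exprMn; apply: le_trans (ler_pM _ _ c1 c2) _; rewrite ?sqr_ge0//.
    by rewrite le_eqVlt; apply/orP; left; apply/eqP; ring.
  have p1 : 0 <= n1 * u2 by exact: mulr_ge0. have p2 : 0 <= m1 * u1 by exact: mulr_ge0.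
  have key2 : 2 * (x1 * x2) <= n1 * u2 + m1 * u1.
    rewrite -(@ler_pXn2r _ 2)// ?nnegrE ?mulr_ge0 ?addr_ge0//.
    have := sqr_ge0 (n1 * u2 - m1 * u1); move: key; nra.
  nra.
have rl := restricted_eigenvalue; rewrite -/n2 in rl.
have Q1 : k2 / (2 * S) * X ^+ 2 <= (N%:R * T%:R)^-1 * Q.
  apply: le_trans rl.
  have B2 : B ^+ 2 <= 25 * X ^+ 2 by nra.
  (* Origin of the 50: [B ^+ 2 <= 25 * X ^+ 2] in the cone, and the Gram error may consume half of
     [k2 / S * X ^+ 2]. *)
  have s1 : Delta * B ^+ 2 <= k2 / (2 * S) * X ^+ 2.
    apply: (@le_trans _ _ (Delta * (25 * X ^+ 2))); first exact: ler_wpM2l.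
    rewrite DeltaE le_eqVlt; apply/orP; left; apply/eqP; field; rewrite gt_eqF//.
  have s2 : k2 / S * X ^+ 2 <= k2 * n2.
    by rewrite -mulrA ler_pM2l// mulrC ler_pdivrMr// mulrC.
  have -> : k2 / (2 * S) * X ^+ 2 = k2 / S * X ^+ 2 - k2 / (2 * S) * X ^+ 2.
    by field; rewrite gt_eqF.
  lra.
have XS : X <= 10 * l * S / k2.
  have lB : 0 <= l * B by rewrite mulr_ge0// ltW.
  have : k2 / (2 * S) * X ^+ 2 <= 5 * l * X by lra.
  rewrite expr2 mulrA ler_pM2r// ler_pdivlMr// => h'.
  have : k2 / (2 * S) * X * (2 * S) <= 5 * l * (2 * S).
    by rewrite ler_pM2r// mulr_gt0.
  have -> : k2 / (2 * S) * X * (2 * S) = X * k2 by field; rewrite gt_eqF.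
  lra.
apply: le_trans bi5 _.
have le0 : 0 <= 20 * l * e by rewrite mulr_ge0// mulr_ge0// ltW.
have := ler_wpM2l (ltW l0) XS.
have -> : l * (10 * l * S / k2) = (120 / k2 * l ^+ 2 * S) / 12 by field; rewrite gt_eqF.
lra.
Qed.
End Oracle.
End Deterministic.

(** * Concentration in the panel model *)

Section Averages.
Context d (Om : measurableType d) (R : realType) (P : probability Om R).
Implicit Types (X Y S : Om -> R).
Local Notation Ex := (Rintegral P setT).

Lemma jensen_average (T : nat) (x : 'I_T -> R) k : (0 < T)%N -> (0 < k)%N ->
  (T%:R^-1 * \sum_t x t) ^+ k.*2 <= T%:R^-1 * \sum_t x t ^+ k.*2.
Proof.
move=> T0 k0; have TR : 0 < T%:R :> R by rewrite ltr0n.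
set y := T%:R^-1 * _; rewrite ler_pdivlMl//.
have yE : \sum_t x t = T%:R * y by rewrite /y mulVKf// gt_eqF.
apply: le_trans (_ : \sum_t (y ^+ k.*2 + k.*2%:R * y ^+ k.*2.-1 * (x t - y)) <= _); last first.
  by apply: ler_sum => t _; exact: even_power_tangent.
rewrite big_split /= -mulr_sumr sumrB !sumr_const card_ord yE -[y *+ T]mulr_natl.
by rewrite subrr mulr0 addr0 mulr_natl.
Qed.

(** Jensen's inequality over dates keeps the constant whatever the dependence over time. *)
Lemma subexponential_average (T : nat) (X : 'I_T -> Om -> R) (c : R) : (0 < T)%N ->
  (forall t, subexponential P c (X t)) ->
  subexponential P c (fun w => T%:R^-1 * \sum_t X t w).
Proof.
move=> T0 hX; have TR : 0 < T%:R :> R by rewrite ltr0n.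
have aS : all_moments P (fun w => T%:R^-1 * \sum_t X t w).
  by apply: all_moments_Z; apply: all_moments_sum => t _; case: (hX t).
split=> // k k0.
have iX t : P.-integrable setT (EFin \o (fun w => X t w ^+ k.*2)) by case: (hX t) => -[].
apply: le_trans (_ : Ex (fun w => T%:R^-1 * \sum_t X t w ^+ k.*2) <= _).
  apply: le_Rintegral => //.
  - by case: aS.
  - by apply: integrable_scale; exact: integrable_sum.
  - by move=> w _; exact: jensen_average.
rewrite RintegralZl//; last exact: integrable_sum.
rewrite Ex_sum// ler_pdivrMl//.
apply: le_trans (_ : \sum_(t < T) (c * k%:R ^+ 2) ^+ k <= _).
  by apply: ler_sum => t _; case: (hX t) => _; apply.
by rewrite sumr_const card_ord mulr_natl.
Qed.

(** [(x - mu)^(2k)] is at most [4^k] times the mean of [x^(2k)] and [mu^(2k)], by convexity, and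
    [mu^(2k)] is at most the moment of [X] by Jensen's inequality. *)
Lemma subexponential_center X (c : R) : subexponential P c X ->
  subexponential P (4 * c) (fun w => X w - Ex X).
Proof.
move=> [aX bX]; set mu := Ex X.
have iX := all_moments_integrable aX.
have aV : all_moments P (fun w => X w - mu).
  by apply: (all_moments_D aX); exact: all_moments_cst.
split=> // k k0; have i2 : P.-integrable setT (EFin \o (fun w => X w ^+ k.*2)) by case: aX.
have jensen : mu ^+ k.*2 <= Ex (fun w => X w ^+ k.*2).
  apply: le_trans (_ : Ex (fun w => mu ^+ k.*2 + k.*2%:R * mu ^+ k.*2.-1 * (X w - mu)) <= _).
    rewrite RintegralD//; [|exact: integrable_constant|].
      rewrite RintegralZl//; last exact: all_moments_integrable.
      rewrite RintegralB//; last exact: integrable_constant.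
      by rewrite !Ex_cst subrr mulr0 addr0.
    by apply: integrable_scale; exact: all_moments_integrable.
  apply: le_Rintegral => //.
  - apply: integrable_addr; first exact: integrable_constant.
    by apply: integrable_scale; exact: all_moments_integrable.
  - by move=> w _; exact: even_power_tangent.
have pt w : (X w - mu) ^+ k.*2 <= 2^-1 * 4 ^+ k * (X w ^+ k.*2 + mu ^+ k.*2).
  set x := X w; pose y := (x - mu) / 2.
  have -> : (x - mu) ^+ k.*2 = 4 ^+ k * y ^+ k.*2.
    by rewrite -!mul2n !exprM -exprMn; congr (_ ^+ _); rewrite /y; field.
  rewrite [2^-1 * _]mulrC -mulrA; apply: ler_wpM2l; first by rewrite exprn_ge0.
  have := even_power_tangent x y k0; have := even_power_tangent (- mu) y k0.
  have -> : (- mu) ^+ k.*2 = mu ^+ k.*2 by rewrite exprNn -signr_odd odd_double expr0 mul1r.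
  have -> : - mu - y = - (x - y) by rewrite /y; field.
  by lra.
have c0 : 0 <= 2^-1 * 4 ^+ k :> R by rewrite mulr_ge0// exprn_ge0.
apply: le_trans (_ : Ex (fun w => 2^-1 * 4 ^+ k * (X w ^+ k.*2 + mu ^+ k.*2)) <= _).
  apply: le_Rintegral => //; first by case: aV.
  by apply: integrable_scale; apply: integrable_addr => //; exact: integrable_constant.
rewrite RintegralZl//; last by apply: integrable_addr => //; exact: integrable_constant.
rewrite RintegralD//; last exact: integrable_constant.
rewrite Ex_cst -(mulrA 4 c) [leRHS]exprMn.
have b := bX k k0.
have h4 : 0 <= 4 ^+ k :> R by exact: exprn_ge0.
have b2 : Ex (fun w => X w ^+ k.*2) + mu ^+ k.*2 <= 2 * (c * k%:R ^+ 2) ^+ k by lra.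
have := ler_wpM2l h4 b2; lra.
Qed.

(** Iteration of [moment_step]: each increment adds [4 * k] to the variance proxy. The initial sum
    [S] allows a chain over dates to continue one over units. *)
Lemma moment_chain (n k : nat) (X : 'I_n -> Om -> R) S (a m2 : R) :
  (0 < k)%N -> 0 < a -> 0 < m2 ->
  all_moments P S -> (forall j, all_moments P (X j)) ->
  (forall j, Ex (fun w => X j w ^+ k.*2) <= m2 ^+ k) ->
  (forall j : 'I_n, Ex (fun w => (S w + \sum_(j' < n | (j' < j)%N) X j' w) ^+ k.*2.-1 * X j w) = 0) ->
  Ex (fun w => S w ^+ k.*2) <= (a * m2) ^+ k ->
  Ex (fun w => (S w + \sum_j X j w) ^+ k.*2) <= ((a + n%:R * (4 * k)%:R) * m2) ^+ k.
Proof.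
move=> k0 a0 m0 aS aX bX orth bS.
have main m : (m <= n)%N -> Ex (fun w => (S w + \sum_(j < n | (j < m)%N) X j w) ^+ k.*2)
    <= ((a + m%:R * (4 * k)%:R) * m2) ^+ k.
  elim: m => [|m IH] mn.
    rewrite mul0r addr0; apply: le_trans bS; rewrite le_eqVlt; apply/orP; left; apply/eqP.
    by apply: eq_Rintegral => w _; rewrite big_pred0 ?addr0.
  rewrite (_ : (fun w => _) = fun w => ((S w + \sum_(j < n | (j < m)%N) X j w)
     + X (Ordinal mn) w) ^+ k.*2).
    have -> : a + m.+1%:R * (4 * k)%:R = a + m%:R * (4 * k)%:R + (4 * k)%:R.
      by rewrite -(natr1 m); ring.
    apply: moment_step => //.
    - by rewrite ltr_wpDr// mulr_ge0.
    - by apply: all_moments_D => //; exact: all_moments_sum.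
    - by apply: IH; exact: ltnW.
    - exact: orth (Ordinal mn).
  apply/funext => w; rewrite (bigD1 (Ordinal mn))//= addrCA addrC; congr ((_ + _ + _) ^+ _).
  by apply: eq_bigl => j; rewrite ltnS -val_eqE /= andbC ltn_neqAle.
have := main n (leqnn n); apply: le_trans; rewrite le_eqVlt; apply/orP; left; apply/eqP.
by apply: eq_Rintegral => w _; congr ((_ + _) ^+ _); apply: eq_bigl => j; rewrite ltn_ord.
Qed.
End Averages.

(** * Measurability, orthogonality and moments in the panel *)

Section Model.
Context d (Om : measurableType d) (R : realType) (P : probability Om R).
Context (N T L px : nat) (D : panel P N T L px).
Context (alpha : 'cV[R]_(L + px)) (eta : 'cV[R]_N) (C K : R).
Hypotheses (C_gt0 : 0 < C) (K_gt0 : 0 < K).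
Hypothesis model : panel_model D alpha eta.
Hypothesis indep : indep_families P (unit_block D).
Hypothesis condexp : forall i t, is_cond_exp P (sigma_gen (history D i t)) (err D i t) (cst 0).
Hypothesis tails : assumption3 D C K.
Local Notation Ex := (Rintegral P setT).

(** The generators inside [sigma_gen]: [sigma_gen F] is, by definition, the sigma-algebra generated
    by [generating F]. *)
Definition generating (F : set (Om -> R)) : set (set Om) :=
  \bigcup_(f in F) preimage_set_system setT f measurable.

Lemma generating_measurable (F : set (Om -> R)) f : F f -> gen_measurable (generating F) f.
Proof.
move=> Ff; apply/gen_measurableP => B mB; apply: sub_sigma_algebra.
by exists f => //; exists B => //; rewrite setTI.
Qed.

Definition reg i t l (w : Om) : R := regressor D i t w l 0.

Lemma reg_lshift i t (l : 'I_L) : reg i t (lshift px l) = obs D i (t%:Z - l%:Z).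
Proof. by apply/funext => w; rewrite /reg /regressor col_mxEu mxE. Qed.

Lemma reg_rshift i t (k : 'I_px) : reg i t (rshift L k) = cov D i t k.
Proof. by apply/funext => w; rewrite /reg /regressor col_mxEd mxE. Qed.

Lemma reg_measurable i t l : measurable_fun setT (reg i t l).
Proof.
case: (splitP l) => j lE.
  have -> : l = lshift px j by apply/val_inj.
  by rewrite reg_lshift.
have -> : l = rshift L j by apply/val_inj.
by rewrite reg_rshift.
Qed.

Lemma err_model i t : err D i t = (fun w => obs D i t.+1%:Z w -
  (\sum_(l < L) usubmx alpha l 0 * obs D i (t%:Z - l%:Z) w
      + \sum_(k < px) cov D i t k w * dsubmx alpha k 0 + eta i 0)) :> (Om -> R).
Proof. by apply/funext => w; rewrite model addrAC subrr add0r. Qed.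

(** Initial observations belong to the block; later ones follow by solving the model forward in
    time. *)
Lemma obs_unit_measurable i (n : nat) (s : int) : (n <= T)%N -> 1 - L%:Z <= s <= n%:Z ->
  gen_measurable (generating (unit_block D i)) (obs D i s).
Proof.
elim: n s => [|n IH] s nT /andP[sl su].
  have sL : (`|s|%N < L)%N by lia.
  apply: generating_measurable; left; exists (Ordinal sL).
  by congr (obs D i _); rewrite /=; lia.
have [sn|sn] := leP s n%:Z; first by apply: IH; [lia|rewrite sl].
have -> : s = n.+1%:Z by lia.
pose t := Ordinal nT.
rewrite (_ : (obs D i n.+1%:Z : Om -> R) = fun w =>
  \sum_(l < L) usubmx alpha l 0 * obs D i (t%:Z - l%:Z) w
      + \sum_(k < px) cov D i t k w * dsubmx alpha k 0 + eta i 0 + err D i t w); last first.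
  by apply/funext => w; exact: (model i t).
apply: gen_measurableD; [apply: gen_measurableD; [apply: gen_measurableD|]|].
- apply: gen_measurable_sum => l _; apply: gen_measurableM; first exact: gen_measurable_cst.
  by apply: IH; [lia|have := ltn_ord l; rewrite /=; lia].
- apply: gen_measurable_sum => l _; apply: gen_measurableM; last exact: gen_measurable_cst.
  by apply: generating_measurable; right; left; exists t, l.
- exact: gen_measurable_cst.
- by apply: generating_measurable; right; right; exists t.
Qed.

Lemma reg_unit_measurable i t l : gen_measurable (generating (unit_block D i)) (reg i t l).
Proof.
case: (splitP l) => j lE.
  have -> : l = lshift px j by apply/val_inj.
  rewrite reg_lshift; apply: (@obs_unit_measurable i t); first exact: ltnW.
  by have := ltn_ord j; lia.
have -> : l = rshift L j by apply/val_inj.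
by rewrite reg_rshift; apply: generating_measurable; right; left; exists t, j.
Qed.

Lemma err_unit_measurable i t : gen_measurable (generating (unit_block D i)) (err D i t).
Proof. by apply: generating_measurable; right; right; exists t. Qed.

Lemma obs_history_measurable i (t : 'I_T) (s : int) : 1 - L%:Z <= s <= t%:Z ->
  gen_measurable (generating (history D i t)) (obs D i s).
Proof. by move=> h; apply: generating_measurable; left; exists s. Qed.

Lemma cov_history_measurable i (t t' : 'I_T) k : (t' <= t)%N ->
  gen_measurable (generating (history D i t)) (cov D i t' k).
Proof. by move=> h; apply: generating_measurable; right; exists t' => //; exists k. Qed.

Lemma reg_history_measurable i (t t' : 'I_T) l : (t' <= t)%N ->
  gen_measurable (generating (history D i t)) (reg i t' l).
Proof.
move=> tt; case: (splitP l) => j lE.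
  have -> : l = lshift px j by apply/val_inj.
  rewrite reg_lshift; apply: obs_history_measurable.
  by have := ltn_ord j; lia.
have -> : l = rshift L j by apply/val_inj.
by rewrite reg_rshift; exact: cov_history_measurable.
Qed.

(** The model, solved for the error, expresses it through outcomes and covariates already in the
    history at the later index; partial sums of scores are therefore history-measurable. *)
Lemma err_history_measurable i (t t' : 'I_T) : (t' < t)%N ->
  gen_measurable (generating (history D i t)) (err D i t').
Proof.
move=> tt; rewrite err_model; apply: gen_measurableB.
  by apply: obs_history_measurable; lia.
apply: gen_measurableD; last exact: gen_measurable_cst.
apply: gen_measurableD; apply: gen_measurable_sum => l _; apply: gen_measurableM;
  try exact: gen_measurable_cst.
  by apply: obs_history_measurable; have := ltn_ord l; lia.
by apply: cov_history_measurable; exact: ltnW.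
Qed.

Lemma unit_block_measurable i f : unit_block D i f -> measurable_fun setT f.
Proof. by case=> [[l ->]|[[t [k ->]]|[t ->]]]. Qed.

Let cm := subexp_const C K.

Lemma err_subexp i t : subexponential P cm (err D i t).
Proof.
apply: subexponential_subgaussian => // e e0.
by have [] := tails e0 i t.
Qed.

Lemma reg_subexp i t l : subexponential P cm (reg i t l).
Proof.
apply: subexponential_subgaussian => //; first exact: reg_measurable.
by move=> e e0; have [_] := tails e0 i t; apply.
Qed.

Lemma reg_err_subexp i t l : subexponential P cm (fun w => reg i t l w * err D i t w).
Proof.
apply: subexponential_mul => //; first exact: reg_measurable.
- by move=> e e0; have [_] := tails e0 i t; apply.
- by move=> e e0; have [] := tails e0 i t.
Qed.

Lemma reg_reg_subexp i t l m : subexponential P cm (fun w => reg i t l w * reg i t m w).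
Proof.
apply: subexponential_mul => //; try exact: reg_measurable.
- by move=> e e0; have [_] := tails e0 i t; apply.
- by move=> e e0; have [_] := tails e0 i t; apply.
Qed.

(** Conditional mean zero gives the claim for indicators of history events, and [orthogonal] extends
    it to unbounded [g]. *)
Lemma innovation_orthogonal i t g : all_moments P g ->
  gen_measurable (generating (history D i t)) g -> Ex (fun w => g w * err D i t w) = 0.
Proof.
move=> ag mg; have [ie _ _ ce] := condexp i t.
have aE : all_moments P (err D i t) by case: (err_subexp i t).
apply: orthogonal => //.
- by case: ag.
- by apply: all_moments_integrable; exact: all_moments_M.
move=> B mB; have sB : sigma_gen (history D i t) (g @^-1` B).
  by exact: ((gen_measurableP _ _).1 mg).
have := ce _ sB; rewrite integral0 => h.
rewrite (_ : (fun w => _) = (err D i t : Om -> R) \_ (g @^-1` B)).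
  by rewrite -Rintegral_mkcond /Rintegral h.
apply/funext => w; rewrite patchE indicE (_ : (w \in g @^-1` B) = (g w \in B))//.
by case: ifP; rewrite ?mul1r ?mul0r.
Qed.

Definition past (i : 'I_N) : pred 'I_N := fun j => (j < i)%N.

Lemma past_measurable (i j : 'I_N) (f : Om -> R) : (j < i)%N ->
  gen_measurable (generating (unit_block D j)) f ->
  gen_measurable (joint_events (unit_block D) (past i)) f.
Proof.
move=> ji /gen_measurableP mf; apply/gen_measurableP => B mB.
by apply: sub_sigma_algebra; apply: (@joint_events_sigma_gen _ _ _ _ _ _ j) => //; exact: mf.
Qed.

Lemma past_orthogonal (i : 'I_N) f g : all_moments P f -> all_moments P g ->
  gen_measurable (generating (unit_block D i)) f ->
  gen_measurable (joint_events (unit_block D) (past i)) g ->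
  Ex f = 0 -> Ex (fun w => g w * f w) = 0.
Proof.
move=> af ag /gen_measurableP mf mg f0.
apply: (indep_orthogonal (@unit_block_measurable) indep (J := past i) (i := i)) => //.
- by rewrite /past ltnn.
- exact: all_moments_integrable.
- by apply: all_moments_integrable; exact: all_moments_M.
Qed.

Let X l i t w := reg i t l w * err D i t w.

(** In the binomial expansion, the factor [B ^+ j * reg * err] of unit [i] has mean zero because
    [err] is an innovation, and [A ^+ (n - j)] depends on earlier units only, so independence kills
    each product. *)
Lemma score_orthogonal l (i : 'I_N) (t : 'I_T) n :
  Ex (fun w => ((\sum_(i' < N | (i' < i)%N) \sum_t' X l i' t' w)
    + \sum_(t' < T | (t' < t)%N) X l i t' w) ^+ n * X l i t w) = 0.
Proof.
have aX i' t' : all_moments P (X l i' t') by case: (reg_err_subexp i' t' l).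
have aZ i' t' : all_moments P (reg i' t' l) by case: (reg_subexp i' t' l).
have aE i' t' : all_moments P (err D i' t') by case: (err_subexp i' t').
have mXu i' t' : gen_measurable (generating (unit_block D i')) (X l i' t').
  by apply: gen_measurableM; [exact: reg_unit_measurable|exact: err_unit_measurable].
set A := fun w => \sum_(i' < N | (i' < i)%N) \sum_t' X l i' t' w.
set B := fun w => \sum_(t' < T | (t' < t)%N) X l i t' w.
have aA : all_moments P A by apply: all_moments_sum => i' _; exact: all_moments_sum.
have aB : all_moments P B by exact: all_moments_sum.
have aBZ j : all_moments P (fun w => B w ^+ j * reg i t l w).
  by apply: all_moments_M => //; exact: all_moments_X.
have aBX j : all_moments P (fun w => B w ^+ j * reg i t l w * err D i t w).
  exact: all_moments_M.
have mA : gen_measurable (joint_events (unit_block D) (past i)) A.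
  apply: gen_measurable_sum => i' i'i; apply: gen_measurable_sum => t' _.
  exact: past_measurable i'i (mXu _ _).
have mBu : gen_measurable (generating (unit_block D i)) B by exact: gen_measurable_sum.
have mBh : gen_measurable (generating (history D i t)) B.
  apply: gen_measurable_sum => t' t't; apply: gen_measurableM.
    by apply: reg_history_measurable; exact: ltnW.
  exact: err_history_measurable.
have zero j : Ex (fun w => A w ^+ (n - j) * (B w ^+ j * reg i t l w * err D i t w)) = 0.
  apply: (@past_orthogonal i); [exact: aBX|exact: all_moments_X| | |].
  - apply: gen_measurableM; last exact: err_unit_measurable.
    by apply: gen_measurableM; [exact: gen_measurableX|exact: reg_unit_measurable].
  - exact: gen_measurableX.
  - apply: innovation_orthogonal; first exact: aBZ.
    by apply: gen_measurableM; [exact: gen_measurableX|exact: reg_history_measurable].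
rewrite (_ : (fun w => _) = fun w => \sum_(j < n.+1)
    'C(n, j)%:R * (A w ^+ (n - j) * (B w ^+ j * reg i t l w * err D i t w))).
  have iz j : P.-integrable setT (EFin \o
      (fun w => A w ^+ (n - j) * (B w ^+ j * reg i t l w * err D i t w))).
    by apply: all_moments_integrable; apply: all_moments_M; [exact: all_moments_X|exact: aBX].
  rewrite Ex_sum => [|j _]; last exact: integrable_scale.
  by apply: big1 => j _; rewrite RintegralZl// zero mulr0.
apply/funext => w; rewrite exprDn mulr_suml; apply: eq_bigr => j _.
by rewrite -mulr_natl /X; ring.
Qed.

(** The factor 4 covers the centred Gram averages, so that one bound fits all increments. *)
Let m2 (k : nat) : R := 4 * cm * k%:R ^+ 2.

Lemma cm_gt0 : 0 < cm.
Proof.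
rewrite mulr_gt0//; first by apply: lt_le_trans (exp_moment_ge1 K_gt0).
by apply: addr_gt0; apply: divr_gt0 => //; exact: exprn_gt0.
Qed.

Lemma m2_gt0 k : (0 < k)%N -> 0 < m2 k.
Proof.
move=> k0; apply: mulr_gt0; last by rewrite exprn_gt0// ltr0n.
by apply: mulr_gt0 => //; exact: cm_gt0.
Qed.

Lemma subexp_m2 Y k : subexponential P cm Y -> (0 < k)%N -> Ex (fun w => Y w ^+ k.*2) <= m2 k ^+ k.
Proof.
move=> [_ bY] k0; apply: le_trans (bY k k0) _; apply: ler_pow_base.
  by rewrite mulr_ge0 ?sqr_ge0// ltW// cm_gt0.
by apply: ler_wpM2r; rewrite ?sqr_ge0//; have := cm_gt0; lra.
Qed.

(** Induction on units with a chain over dates at each stage. The extra [4 * k] is the starting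
    proxy of the empty sum, as [moment_step] asks for a positive one. *)
Lemma score_moments l k : (0 < k)%N ->
  Ex (fun w => (\sum_i \sum_t X l i t w) ^+ k.*2)
    <= (((4 * k)%:R + (N * T)%:R * (4 * k)%:R) * m2 k) ^+ k.
Proof.
move=> k0; have m0 := m2_gt0 k0.
have aX i t : all_moments P (X l i t) by case: (reg_err_subexp i t l).
have k4 : 0 < (4 * k)%:R :> R by rewrite ltr0n muln_gt0.
have main n : (n <= N)%N -> Ex (fun w => (\sum_(i < N | (i < n)%N) \sum_t X l i t w) ^+ k.*2)
    <= (((4 * k)%:R + (n * T)%:R * (4 * k)%:R) * m2 k) ^+ k.
  elim: n => [|n IH] nN.
    rewrite (_ : (fun w => _) = fun=> 0).
      by rewrite Ex_cst mul0n mul0r addr0 exprn_ge0// mulr_ge0// ltW.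
    by apply/funext => w; rewrite big_pred0// expr0n double_eq0 gtn_eqF.
  rewrite (_ : (fun w => _) = fun w => (\sum_(i < N | (i < n)%N) \sum_t X l i t w
     + \sum_t X l (Ordinal nN) t w) ^+ k.*2).
    have -> : (4 * k)%:R + (n.+1 * T)%:R * (4 * k)%:R =
        ((4 * k)%:R + (n * T)%:R * (4 * k)%:R) + T%:R * (4 * k)%:R :> R.
      by rewrite mulSn natrD; ring.
    apply: moment_chain => //.
    - by rewrite ltr_wpDr// mulr_ge0.
    - by apply: all_moments_sum => i _; exact: all_moments_sum.
    - by move=> t; apply: subexp_m2 => //; exact: reg_err_subexp.
    - by move=> t; exact: (score_orthogonal l (Ordinal nN) t).
    - by apply: IH; exact: ltnW.
  apply/funext => w; rewrite (bigD1 (Ordinal nN))//= addrC; congr ((_ + _) ^+ _).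
  by apply: eq_bigl => j; rewrite ltnS -val_eqE /= andbC ltn_neqAle.
have := main N (leqnn N); apply: le_trans; rewrite le_eqVlt; apply/orP; left; apply/eqP.
by apply: eq_Rintegral => w _; congr (_ ^+ _); apply: eq_bigl => j; rewrite ltn_ord.
Qed.

Lemma err_sum_moments i k : (0 < k)%N ->
  Ex (fun w => (\sum_t err D i t w) ^+ k.*2)
    <= (((4 * k)%:R + T%:R * (4 * k)%:R) * m2 k) ^+ k.
Proof.
move=> k0; have m0 := m2_gt0 k0.
have aE t : all_moments P (err D i t) by case: (err_subexp i t).
have k4 : 0 < (4 * k)%:R :> R by rewrite ltr0n muln_gt0.
rewrite (_ : (fun w => _) = fun w => (0 + \sum_t err D i t w) ^+ k.*2); last first.
  by apply/funext => w; rewrite add0r.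
apply: moment_chain => //.
- exact: all_moments_cst.
- by move=> t; apply: subexp_m2 => //; exact: err_subexp.
- move=> t; apply: innovation_orthogonal.
    apply: all_moments_X; apply: all_moments_D; first exact: all_moments_cst.
    exact: all_moments_sum.
  apply: gen_measurableX; apply: gen_measurableD; first exact: gen_measurable_cst.
  by apply: gen_measurable_sum => t' t't; exact: err_history_measurable.
- rewrite expr0n double_eq0 gtn_eqF// Ex_cst exprn_ge0// mulr_ge0// ltW//.
Qed.

Hypothesis T_gt0 : (0 < T)%N.

(** One term per unit: dependence over time stays inside it, and the sum over units has [N]
    independent terms. Hence [N], not [N * T], in the Gram probability. *)
Definition gram i l m w : R := T%:R^-1 * \sum_t reg i t l w * reg i t m w.

Lemma gram_subexp i l m : subexponential P cm (gram i l m).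
Proof. by apply: subexponential_average => // t; exact: reg_reg_subexp. Qed.

Lemma gram_unit_measurable i l m : gen_measurable (generating (unit_block D i)) (gram i l m).
Proof.
apply: gen_measurableM; first exact: gen_measurable_cst.
by apply: gen_measurable_sum => t _; apply: gen_measurableM; exact: reg_unit_measurable.
Qed.

Lemma gram_moments l m k : (0 < k)%N ->
  Ex (fun w => (\sum_i (gram i l m w - Ex (gram i l m))) ^+ k.*2)
    <= (((4 * k)%:R + N%:R * (4 * k)%:R) * m2 k) ^+ k.
Proof.
move=> k0; have m0 := m2_gt0 k0.
have sV i := subexponential_center (gram_subexp i l m).
have aV i : all_moments P (fun w => gram i l m w - Ex (gram i l m)) by case: (sV i).
have k4 : 0 < (4 * k)%:R :> R by rewrite ltr0n muln_gt0.
have mV i : gen_measurable (generating (unit_block D i)) (fun w => gram i l m w - Ex (gram i l m)).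
  by apply: gen_measurableB; [exact: gram_unit_measurable|exact: gen_measurable_cst].
rewrite (_ : (fun w => _) =
    fun w => (0 + \sum_i (gram i l m w - Ex (gram i l m))) ^+ k.*2); last first.
  by apply/funext => w; rewrite add0r.
apply: moment_chain => //.
- exact: all_moments_cst.
- by move=> i; case: (sV i) => _; apply.
- move=> i; apply: (@past_orthogonal i) => //.
  + apply: all_moments_X; apply: all_moments_D; first exact: all_moments_cst.
    exact: all_moments_sum.
  + apply: gen_measurableX; apply: gen_measurableD; first exact: gen_measurable_cst.
    by apply: gen_measurable_sum => i' i'i; exact: past_measurable i'i (mV _).
  + rewrite RintegralB//; last exact: integrable_constant.
      by rewrite Ex_cst subrr.
    by apply: all_moments_integrable; case: (gram_subexp i l m).
- rewrite expr0n double_eq0 gtn_eqF// Ex_cst exprn_ge0// mulr_ge0// ltW//.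
Qed.

(** Solves [b^3 * (32 * cm * e) = 1], the condition in [moment_tail]; 32 collects [n + 1 <= 2n], the
    step [4 * k] and the 4 in [m2]. *)
Definition rate : R := (32 * cm * expR 1) `^ (- 3^-1).

Lemma rate_gt0 : 0 < rate.
Proof.
apply: powR_gt0; apply: mulr_gt0 (expR_gt0 _).
by apply: mulr_gt0 => //; exact: cm_gt0.
Qed.

Lemma concentration Y (n : nat) (q : R) : (0 < n)%N -> 0 < q -> all_moments P Y ->
  (forall k, (0 < k)%N -> Ex (fun w => Y w ^+ k.*2)
    <= (((4 * k)%:R + n%:R * (4 * k)%:R) * m2 k) ^+ k) ->
  fine (P [set w | Num.sqrt (n%:R * q) <= `|Y w|])
    <= expR 1 * expR (- (rate * q `^ (3^-1))).
Proof.
move=> n0 q0 aY bY; have c0 := cm_gt0.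
apply: (@moment_tail _ _ _ _ _ (32 * cm)) => //.
- exact: mulr_gt0.
- exact: rate_gt0.
- by rewrite ltr0n.
- have h : 0 < 32 * cm * expR 1 by apply: mulr_gt0 (expR_gt0 _); exact: mulr_gt0.
  rewrite /rate -powR_mulrn ?powR_ge0// -powRrM mulNr mulVf// powRN powRr1 ?(ltW h)//.
  by rewrite mulVf// gt_eqF.
move=> k k0; apply: le_trans (bY k k0) _; apply: ler_pow_base.
  by rewrite mulr_ge0 ?(ltW (m2_gt0 k0))// addr_ge0// mulr_ge0.
have n1 : 1 <= n%:R :> R by rewrite ler1n.
have -> : 32 * cm * k%:R ^+ 3 * n%:R = (n%:R + n%:R) * (4 * k)%:R * m2 k.
  by rewrite natrM /m2; ring.
apply: ler_wpM2r; first exact: ltW (m2_gt0 k0).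
by rewrite -[X in X + _]mul1r -mulrDl ler_wpM2r// lerD2r.
Qed.
End Model.

(** * The Lasso event *)

Section Auxiliary.
Context {R : realType}.

Lemma kappa2sq_restricted (p : nat) (Psi : 'M[R]_p) (s1 : nat) (kap0 : R) :
  (0 < p)%N -> (0 < s1)%N -> 0 < kap0 -> assumption2 Psi s1 kap0 ->
  kappa2sq Psi s1 <= 1 /\
  forall (J : {set 'I_p}) (v : 'I_p -> R), (#|J| <= s1)%N ->
    kappa2sq Psi s1 * \sum_(l in J) v l ^+ 2 <= \sum_l \sum_m v l * Psi l m * v m.
Proof.
move=> p0 s0 kap_gt0; rewrite /assumption2 /kappa2sq.
set Q := [set q | _]; rewrite le_min => /andP[_ kapQ].
split; first by rewrite ge_min lexx.
move=> J v Js; set k2 := Num.min _ _.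
(* The infimum of a set without lower bound is 0, which the positivity of [kap0] excludes. *)
have hQ : has_inf Q.
  by apply: contrapT => /inf_out h; move: kapQ; rewrite h leNgt kap_gt0.
have quadE (u : 'I_p -> R) :
    ((\col_l u l)^T *m Psi *m (\col_l u l)) 0 0 = \sum_l \sum_m u l * Psi l m * u m.
  rewrite mxE exchange_big; apply: eq_bigr => m _ /=.
  rewrite !mxE mulr_suml; apply: eq_bigr => l _; rewrite !mxE//.
have k2Q (J' : {set 'I_p}) l : (#|J'| <= s1)%N -> l \in J' -> v l != 0 ->
    k2 * \sum_(l in J') v l ^+ 2 <= \sum_l \sum_m v l * Psi l m * v m.
  move=> J's lJ vl.
  have pos : 0 < \sum_(l in J') v l ^+ 2.
    rewrite (bigD1 l)//= ltr_wpDr//; first by apply: sumr_ge0 => m _; exact: sqr_ge0.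
    by rewrite exprn_even_gt0.
  rewrite -ler_pdivlMr//; apply: (@le_trans _ _ (inf Q)); first by rewrite ge_min lexx orbT.
  apply: ge_inf; first by case: hQ.
  exists J', (\col_l v l); split=> //; first by exists l => //; rewrite mxE.
  by rewrite quadE; congr (_ / _); apply: eq_bigr => m _; rewrite mxE.
have k20 : 0 < k2 by rewrite lt_min ltr01 (lt_le_trans kap_gt0).
have [/existsP[l /andP[lJ vl]]|/existsPn h] := boolP [exists l, (l \in J) && (v l != 0)].
  exact: k2Q Js lJ vl.
rewrite big1 ?mulr0; last first.
  by move=> l lJ; have := h l; rewrite lJ negbK => /eqP ->; rewrite expr0n.
(* If [v] vanishes on [J], the form only has to be nonnegative. A singleton at a nonzero coordinate,
   admissible as [0 < s1], shows this. *)
have [/existsP[l vl]|/existsPn h'] := boolP [exists l, v l != 0].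
  apply: le_trans (k2Q [set l]%SET l _ _ vl); rewrite ?cards1 ?set11//.
  by rewrite mulr_ge0 ?(ltW k20)//; apply: sumr_ge0 => m _; exact: sqr_ge0.
apply: sumr_ge0 => l _; apply: sumr_ge0 => m _.
by have := h' l; rewrite negbK => /eqP ->; rewrite !mul0r.
Qed.

Lemma norm2_sq n (v : 'cV[R]_n) : norm2 v ^+ 2 = \sum_k v k 0 ^+ 2.
Proof. by rewrite /norm2 sqr_sqrtr//; apply: sumr_ge0 => k _; exact: sqr_ge0. Qed.

Lemma sum_mxvec (N T : nat) (F : 'I_(N * T) -> R) :
  \sum_k F k = \sum_i \sum_t F (mxvec_index i t).
Proof.
rewrite pair_big /= (reindex (uncurry (@mxvec_index N T))); last exact: curry_mxvec_bij.
by apply: eq_bigr => -[].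
Qed.
End Auxiliary.

Section UnionBound.
Context d (Om : measurableType d) (R : realType) (P : probability Om R).

(** Integrates [1 <= \1_E + \sum_i \1_(bad i)], which holds pointwise. *)
Lemma union_bound (I : finType) (bad : I -> set Om) (E : set Om) :
  (forall i, measurable (bad i)) -> measurable E ->
  (forall w, (forall i, ~ bad i w) -> E w) ->
  1 - \sum_i fine (P (bad i)) <= fine (P E).
Proof.
move=> mbad mE h.
have i1 (A : set Om) : measurable A -> P.-integrable setT (EFin \o (\1_A : Om -> R)).
  move=> mA; apply: (@integrable_dominated _ _ _ _ _ (fun=> 1)) => //.
    by move=> w; rewrite indicE; case: (_ \in _); rewrite ?normr1 ?normr0.
  exact: integrable_constant.
rewrite lerBlDr -(Ex_cst P 1) -(Ex_indic P mE).
under eq_bigr do rewrite -(Ex_indic P (mbad _)).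
rewrite -Ex_sum => [|i _]; last exact: i1.
rewrite -RintegralD//; [|exact: i1|by apply: integrable_sum => i _; exact: i1].
apply: le_Rintegral => //.
- exact: integrable_constant.
- by apply: integrable_addr; [exact: i1|apply: integrable_sum => i _; exact: i1].
- move=> w _; have [[i bi]|nb] := pselect (exists i, bad i w).
    rewrite (bigD1 i)//= (indicE _ (bad i)) (mem_set bi) addrCA lerDl addr_ge0//.
    by apply: sumr_ge0.
  have Ew : E w by apply: h => i bi; apply: nb; exists i.
  by rewrite (mem_set Ew) lerDl sumr_ge0.
Qed.
End UnionBound.

(** * Coordinate form of the stacked model and of the Lasso objective *)

Section PanelAlgebra.
Context d (Om : measurableType d) (R : realType) (P : probability Om R).
Context (N T L px : nat) (D : panel P N T L px).

Lemma panel_model_reg (alpha : 'cV[R]_(L + px)) (eta : 'cV[R]_N) :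
  panel_model D alpha eta -> forall i (t : 'I_T) w,
  obs D i t.+1%:Z w = \sum_l reg D i t l w * alpha l 0 + eta i 0 + err D i t w.
Proof.
move=> mod i t w; rewrite mod; congr (_ + _ + _); rewrite big_split_ord /=.
congr (_ + _); apply: eq_bigr => l _.
  by rewrite reg_lshift mxE mulrC.
by rewrite reg_rshift mxE.
Qed.

Lemma Pi_mxE w (g : 'cV[R]_(L + px + N)) i t :
  (Pi_mx D w *m g) (mxvec_index i t) 0
    = \sum_l reg D i t l w * usubmx g l 0 + dsubmx g i 0.
Proof.
rewrite -{1}(vsubmxK g) mul_row_col mxE; congr (_ + _); rewrite mxE.
  by apply: eq_bigr => l _; rewrite !mxE mxvecE mxE.
rewrite (bigD1 i)//= big1 ?addr0 => [|j ji]; rewrite !mxE mxvecE mxE.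
  by rewrite eqxx mul1r.
by rewrite eq_sym (negbTE ji) mul0r.
Qed.

Lemma y_vecE w i (t : 'I_T) : y_vec D w (mxvec_index i t) 0 = obs D i t.+1%:Z w.
Proof. by rewrite mxE mxvecE mxE. Qed.

Lemma prediction_norm w (g : 'cV[R]_(L + px + N)) alpha eta :
  norm2 (Pi_mx D w *m (g - col_mx alpha eta)) ^+ 2 =
  \sum_i \sum_t (\sum_l reg D i t l w * (usubmx g l 0 - alpha l 0)
     + (dsubmx g i 0 - eta i 0)) ^+ 2.
Proof.
rewrite norm2_sq sum_mxvec; apply: eq_bigr => i _; apply: eq_bigr => t _.
rewrite Pi_mxE; congr ((_ + _) ^+ 2).
  by apply: eq_bigr => l _; rewrite linearB /= col_mxKu !mxE.
by rewrite linearB /= col_mxKd !mxE.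
Qed.

Lemma lasso_objectiveE (alpha : 'cV[R]_(L + px)) (eta : 'cV[R]_N) lam w g :
  panel_model D alpha eta -> lasso_objective D lam w g =
  \sum_i \sum_t (err D i t w - (\sum_l reg D i t l w * (usubmx g l 0 - alpha l 0)
     + (dsubmx g i 0 - eta i 0))) ^+ 2
  + 2 * lam * \sum_l `|usubmx g l 0| + 2 * (lam / Num.sqrt N%:R) * \sum_i `|dsubmx g i 0|.
Proof.
move=> mod; rewrite /lasso_objective /norm1; congr (_ + _ + _).
rewrite norm2_sq sum_mxvec; apply: eq_bigr => i _; apply: eq_bigr => t _.
rewrite [X in X ^+ 2](_ : _ = y_vec D w (mxvec_index i t) 0
   - (Pi_mx D w *m g) (mxvec_index i t) 0); last by rewrite !mxE.
rewrite y_vecE Pi_mxE (panel_model_reg mod); congr (_ ^+ 2).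
under [in RHS]eq_bigr do rewrite mulrBr.
by rewrite sumrB; ring.
Qed.

Lemma Psi_ZE l m : (0 < T)%N -> (forall i t, P.-integrable setT
    (EFin \o (fun w => reg D i t l w * reg D i t m w))) ->
  Psi_Z D l m = N%:R^-1 * \sum_i Rintegral P setT (gram D i l m).
Proof.
move=> T0 ii; rewrite mxE invfM -mulrA mulr_sumr; congr (_ * _); apply: eq_bigr => i _.
rewrite /gram RintegralZl//; last exact: integrable_sum.
rewrite Ex_sum//; congr (_ * _); apply: eq_bigr => t _.
rewrite unlock /Rintegral; congr fine; apply: eq_integral => w _; congr EFin.
by rewrite [LHS]mxE big_ord1 [X in _ * X]mxE.
Qed.
End PanelAlgebra.

Section LassoBounds.
Context d (Om : measurableType d) (R : realType) (P : probability Om R).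
Context (N T L px : nat) (D : panel P N T L px).

(** [oracle_bound] with [J1] the support of [alpha] and [J2] the fixed effects larger than [r]; by
    [sparse_tail], [S] bounds their total number. All three bounds come from that one inequality,
    whose left side is a sum of nonnegative terms. *)
Lemma lasso_bounds (s1 : nat) (nu E lam k2 : R) (Psi : 'M[R]_(L + px))
  (alpha : 'cV[R]_(L + px)) (eta : 'cV[R]_N) (g : 'cV[R]_(L + px + N)) (w : Om) :
  (0 < N)%N -> (0 < T)%N -> (0 < s1)%N -> 0 < nu < 1 -> 0 < E -> 0 < lam -> 0 < k2 -> k2 <= 1 ->
  let r : R := lam / (Num.sqrt N%:R * T%:R) in
  let S : R := s1%:R + E * r `^ (- nu) in
  calF (L + px) N s1 nu E (alpha, eta) ->
  panel_model D alpha eta ->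
  (forall (J : {set 'I_(L + px)}) (v : 'I_(L + px) -> R), (#|J| <= s1)%N ->
    k2 * \sum_(l in J) v l ^+ 2 <= \sum_l \sum_m v l * Psi l m * v m) ->
  lasso_objective D lam w g <= lasso_objective D lam w (col_mx alpha eta) ->
  (forall l, `|\sum_i \sum_t reg D i t l w * err D i t w| <= lam / 2) ->
  (forall i, `|\sum_t err D i t w| <= lam / Num.sqrt N%:R / 2) ->
  (forall l m, `|(N%:R * T%:R)^-1 * (\sum_i \sum_t reg D i t l w * reg D i t m w) - Psi l m|
     <= k2 / (50 * S)) ->
  (forall i l, `|T%:R^-1 * \sum_t reg D i t l w| <= k2 / (50 * S) * Num.sqrt N%:R) ->
  [/\ (N%:R * T%:R)^-1 * norm2 (Pi_mx D w *m (g - col_mx alpha eta)) ^+ 2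
      <= 120 * lam ^+ 2 * s1%:R / (k2 * (N%:R * T%:R) ^+ 2)
         + (120 / k2 + 20) * (lam / (Num.sqrt N%:R * (N%:R * T%:R))) * E * r `^ (1 - nu),
      norm1 (usubmx g - alpha)
      <= 120 * lam * s1%:R / (k2 * (N%:R * T%:R))
         + (120 / k2 + 20) * (Num.sqrt N%:R)^-1 * E * r `^ (1 - nu) &
      norm1 (dsubmx g - eta)
      <= 120 * lam * s1%:R / (k2 * (Num.sqrt N%:R * T%:R))
         + (120 / k2 + 20) * E * r `^ (1 - nu)].
Proof.
move=> N0 T0 s10 nu01 E0 lam0 k20 k21 r S [/= alphaF etaF] mod re las hZ hD hG hc.
have SE : S = s1%:R + E * r `^ (- nu) by [].
clearbody S; have rdef : r = lam / (Num.sqrt N%:R * T%:R) by [].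
clearbody r; set sN := Num.sqrt N%:R in rdef hD hc *.
have NR : 0 < N%:R :> R by rewrite ltr0n.
have TR : 0 < T%:R :> R by rewrite ltr0n.
have sN0 : 0 < sN by rewrite sqrtr_gt0.
have sN2 : sN ^+ 2 = N%:R by rewrite sqr_sqrtr// ltW.
have r0 : 0 < r by rewrite rdef divr_gt0// mulr_gt0.
have rho0 : 0 < r `^ (- nu) by exact: powR_gt0.
have S0 : 0 < S by rewrite SE addr_gt0 ?ltr0n// mulr_gt0.
have rE : r `^ (1 - nu) = r * r `^ (- nu).
  by rewrite powRD ?powRr1 ?(ltW r0)//; apply/implyP => _; rewrite gt_eqF.
set rho := r `^ (- nu) in rho0 rE SE.
pose J1 := [set l | alpha l 0 != 0]%SET.
pose J2 := [set i | r < `|eta i 0|]%SET.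
have [cJ2 tJ2] := sparse_tail r0 nu01 etaF; rewrite -/J2 -/rho in cJ2 tJ2.
pose e := E * r * rho / sN.
have e0 : 0 <= e by rewrite ltW// divr_gt0// !mulr_gt0.
pose b2 i := (dsubmx g i 0 - eta i 0) / sN.
have hb2 i : dsubmx g i 0 - eta i 0 = sN * b2 i by rewrite mulrC divfK// gt_eqF.
pose l := lam / (N%:R * T%:R).
have := @oracle_bound R N T (L + px) (fun i t l => reg D i t l w) (fun i t => err D i t w)
  (fun l => alpha l 0) (fun l => usubmx g l 0) (fun i => eta i 0) (fun i => dsubmx g i 0)
  (fun l m => Psi l m) lam sN (k2 / (50 * S)) k2 S e J1 J2 b2 T0 sN0 sN2 lam0 hb2.
move=> /(_ _ hZ hD) main.
have {}main := main _ _ _ _ hG hc k20 k21 (re J1 _ alphaF) _ S0 e0 erefl N0 l erefl.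
have {main} : (N%:R * T%:R)^-1 * norm2 (Pi_mx D w *m (g - col_mx alpha eta)) ^+ 2
   + l * (\sum_k `|usubmx g k 0 - alpha k 0| + \sum_i `|b2 i|)
   <= 120 / k2 * l ^+ 2 * S + 20 * l * e.
  rewrite prediction_norm; apply: main.
  - move: las; rewrite !(lasso_objectiveE _ _ _ mod) !col_mxKu !col_mxKd.
    under [X in _ <= X + _ + _ -> _]eq_bigr do under eq_bigr do
      (rewrite subrr addr0 big1 ?subr0; last by move=> ? _; rewrite subrr mulr0).
    by [].
  - by move=> k; rewrite inE negbK => /eqP.
  - rewrite ler_pdivrMr// /e divfK ?gt_eqF//.
    by rewrite rE mulrA in tJ2.
  - by rewrite ltW// divr_gt0// mulr_gt0.
  - by rewrite SE lerD// ler_nat.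
have l0 : 0 < l by rewrite divr_gt0// mulr_gt0.
have p1 : 0 <= (N%:R * T%:R)^-1 * norm2 (Pi_mx D w *m (g - col_mx alpha eta)) ^+ 2.
  by rewrite mulr_ge0 ?sqr_ge0// invr_ge0 mulr_ge0.
have p2 : 0 <= \sum_k `|usubmx g k 0 - alpha k 0| by exact: sumr_ge0.
have p3 : 0 <= \sum_i `|b2 i| by exact: sumr_ge0.
have n1 : norm1 (usubmx g - alpha) = \sum_k `|usubmx g k 0 - alpha k 0|.
  by apply: eq_bigr => k _; rewrite !mxE.
have n2 : norm1 (dsubmx g - eta) = sN * \sum_i `|b2 i|.
  rewrite /norm1 mulr_sumr; apply: eq_bigr => i _.
  by rewrite [in LHS]mxE [X in _ + X]mxE hb2 normrM gtr0_norm.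
rewrite n1 n2; move: p1 p2 p3; set p := _^-1 * _; set q1 := \sum_k _; set q2 := \sum_i _.
move=> p1 p2 p3 main.
have lq1 : 0 <= l * q1 by rewrite mulr_ge0// ltW.
have lq2 : 0 <= l * q2 by rewrite mulr_ge0// ltW.
set rhs := (X in _ <= X) in main.
(* Since [r = sN * l], the part [l ^+ 2 * E * rho] coming from [S] equals [l * e] and merges with
   the tail term into the factor [120 / k2 + 20]. *)
have rhsE : rhs = l * (120 * lam * s1%:R / (k2 * (N%:R * T%:R)) +
    (120 / k2 + 20) * sN^-1 * E * r `^ (1 - nu)).
  by rewrite /rhs rE /e SE /l rdef -sN2; field; rewrite !gt_eqF.
split.
- have -> : 120 * lam ^+ 2 * s1%:R / (k2 * (N%:R * T%:R) ^+ 2) +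
     (120 / k2 + 20) * (lam / (sN * (N%:R * T%:R))) * E * r `^ (1 - nu) = rhs.
    by rewrite rhsE /l -sN2; field; rewrite !gt_eqF.
  by rewrite mulrDr in main; lra.
- by rewrite -(ler_pM2l l0) -rhsE; rewrite mulrDr in main; lra.
- have -> : 120 * lam * s1%:R / (k2 * (sN * T%:R)) + (120 / k2 + 20) * E * r `^ (1 - nu) =
     sN * (120 * lam * s1%:R / (k2 * (N%:R * T%:R)) +
    (120 / k2 + 20) * sN^-1 * E * r `^ (1 - nu)).
    by rewrite -sN2; field; rewrite !gt_eqF.
  by rewrite ler_pM2l// -(ler_pM2l l0) -rhsE; rewrite mulrDr in main; lra.
Qed.
End LassoBounds.

(** The exponential carries the logarithm of the larger number [m], so one tail bound absorbs a
    union over [p] as well as over [N] events. *)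
Lemma nat_powR_ge (R : realType) (n m : nat) (b b' x : R) : (0 < n)%N -> (n <= m)%N ->
  0 <= x -> 0 <= b -> b <= b' ->
  n%:R * expR (- (b' * (x * ln m%:R))) <= n%:R `^ (1 - b * x).
Proof.
move=> n0 nm x0 b0 bb; have nR : 0 < n%:R :> R by rewrite ltr0n.
have mR : 0 < m%:R :> R by rewrite ltr0n (leq_trans n0).
rewrite powRD; last by apply/implyP => _; rewrite gt_eqF.
rewrite powRr1 ?(ltW nR)// ler_pM2l// /powR (gt_eqF nR) ler_expR mulNr lerN2 mulrA.
have ln0 : 0 <= ln (n%:R : R) by rewrite ln_ge0// ler1n.
have lnm : ln (n%:R : R) <= ln m%:R by rewrite ler_ln ?posrE// ler_nat.
apply: ler_pM => //; first exact: mulr_ge0.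
exact: ler_wpM2r.
Qed.

(* A [let] under the coercion [is_true] cannot be introduced directly. *)
Ltac let_out := lazymatch goal with |- is_true (let x := ?a in @?b x) =>
  change (let x := a in is_true (b x)); cbv beta end.

(** Uniformity over [calF] lies in the order of quantifiers: [A] and [B] precede the dimensions, the
    parameters and the probability space. *)
Theorem theorem1 (R : realType) (C K kap0 C0 : R)
  (C_gt0 : 0 < C) (K_gt0 : 0 < K) (kap0_gt0 : 0 < kap0) (C0_gt0 : 0 < C0) :
  exists A B : R, [/\ 0 < A, 0 < B &
  forall (N T L px s1 : nat) (nu E M : R),
  (0 < N)%N -> (0 < T)%N -> (0 < L + px)%N -> (1 <= s1)%N ->
  0 < nu < 1 -> 0 < E -> 0 < M ->
  let p := (L + px)%N in
  let lam : R := lambdaN M N T p in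
  let r : R := lam / (Num.sqrt N%:R * T%:R) in
  let S : R := s1%:R + E * r `^ (- nu) in
  S <= C0 * Num.sqrt N%:R ->
  forall (alpha : 'cV[R]_(L + px)) (eta : 'cV[R]_N),
  calF (L + px) N s1 nu E (alpha, eta) ->
  forall (d : measure_display) (Om : measurableType d) (P : probability Om R)
    (D : panel P N T L px),
  panel_model D alpha eta ->
  assumption1 D ->
  assumption2 (Psi_Z D) s1 kap0 ->
  assumption3 D C K ->
  forall ghat : Om -> 'cV[R]_(L + px + N), panel_lasso D lam ghat ->
  let k2 : R := kappa2sq (Psi_Z D) s1 in
  let prob_bound : R :=
    1 - A * p%:R `^ (1 - B * M `^ (3^-1))
      - A * N%:R `^ (1 - B * M `^ (3^-1))
      - A * (p%:R ^+ 2 + p%:R * N%:R)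
          * expR (- B * (N%:R / S ^+ 2) `^ (3^-1)) in
  let event : set Om := [set w |
     [/\ (N%:R * T%:R)^-1
           * norm2 (Pi_mx D w *m (ghat w - col_mx alpha eta)) ^+ 2
         <= 120 * lam ^+ 2 * s1%:R / (k2 * (N%:R * T%:R) ^+ 2)
            + (120 / k2 + 20) * (lam / (Num.sqrt N%:R * (N%:R * T%:R)))
              * E * r `^ (1 - nu),
         norm1 (usubmx (ghat w) - alpha)
         <= 120 * lam * s1%:R / (k2 * (N%:R * T%:R))
            + (120 / k2 + 20) * (Num.sqrt N%:R)^-1 * E * r `^ (1 - nu) &
         norm1 (dsubmx (ghat w) - eta)
         <= 120 * lam * s1%:R / (k2 * (Num.sqrt N%:R * T%:R))
            + (120 / k2 + 20) * E * r `^ (1 - nu)]] in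
  (prob_bound%:E <= P event)%E].
Proof.
(* Replaces the required Gram accuracy [k2 / (50 * S)] by the smaller [c0 / S], so that the
   constants do not involve [k2]. *)
pose c0 := kap0 / 50; have c0_gt0 : 0 < c0 by rewrite divr_gt0.
pose rt := rate C K; have rt0 : 0 < rt by exact: rate_gt0.
pose c3 := (c0 ^+ 2) `^ (3^-1); have c30 : 0 < c3 by apply: powR_gt0; exact: exprn_gt0.
(* [rt] serves the noise events; in the Gram events the cube root of [c0 ^+ 2] comes out as the
   factor [c3]. *)
pose B := Num.min rt (rt * c3).
have B0 : 0 < B by rewrite lt_min rt0 mulr_gt0.
have Brt : B <= rt by rewrite ge_min lexx.
have Brt3 : B <= rt * c3 by rewrite ge_min lexx orbT.
have e1 : 1 <= expR 1 :> R by rewrite -[leLHS]expR0 ler_expR.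
exists (expR 1), B; split=> //.
move=> N T L px s1 nu E M N0 T0 p0 s10 nu01 E0 M0 p lam r S _ alpha eta calf
  d Om P D mod [ind ce] a2 a3 ghat [mg opt].
let_out; move=> k2; let_out; move=> prob_bound; let_out; move=> event.
have e0 : 0 <= expR 1 :> R by exact: expR_ge0.
(* For [N = 1] the claimed bound is nonpositive, as [A] is at least 1. For larger [N] the logarithm
   in [lambdaN] is positive, hence [lam] too. *)
have [N1|N1] := leqP N 1.
  apply: le_trans (measure_ge0 P event); rewrite lee_fin /prob_bound.
  have -> : N = 1%N by apply/eqP; rewrite eqn_leq N1.
  rewrite powR1 mulr1.
  have h1 : 0 <= expR 1 * p%:R `^ (1 - B * M `^ 3^-1) by rewrite mulr_ge0 ?powR_ge0.
  have h2 : 0 <= expR 1 * (p%:R ^+ 2 + p%:R * 1) * expR (- B * (1 / S ^+ 2) `^ 3^-1).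
    by rewrite !mulr_ge0 ?expR_ge0// addr_ge0 ?sqr_ge0.
  by lra.
have NR : 0 < N%:R :> R by rewrite ltr0n.
have TR : 0 < T%:R :> R by rewrite ltr0n.
have sN0 : 0 < Num.sqrt N%:R :> R by rewrite sqrtr_gt0.
pose lg : R := ln (maxn p N)%:R.
have lg0 : 0 < lg by rewrite ln_gt0// ltr1n (leq_trans N1)// leq_maxr.
(* Makes [lam / 2] equal to [sqrt (N T q1)], and the level for the error sums equal to
   [sqrt (T q1)]. *)
pose q1 := M * lg ^+ 3.
have q10 : 0 < q1 by apply: mulr_gt0 => //; exact: exprn_gt0.
have lamE : lam = 2 * Num.sqrt ((N * T)%:R * q1).
  rewrite /lam /lambdaN -/lg (_ : _ * _ = 2 ^+ 2 * ((N * T)%:R * q1)).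
    by rewrite sqrtrM ?sqr_ge0// sqrtr_sqr ger0_norm.
  by rewrite natrM /q1; ring.
have lam0 : 0 < lam.
  by rewrite lamE mulr_gt0// sqrtr_gt0 mulr_gt0// ltr0n muln_gt0 N0.
have lamE2 : lam / Num.sqrt N%:R / 2 = Num.sqrt (T%:R * q1).
  rewrite lamE (_ : _ * q1 = N%:R * (T%:R * q1)); last by rewrite natrM mulrA.
  rewrite sqrtrM ?(ltW NR)//; field.
  by rewrite gt_eqF.
have r0 : 0 < r by rewrite divr_gt0// mulr_gt0.
have S0 : 0 < S by rewrite addr_gt0 ?ltr0n// mulr_gt0// powR_gt0.
(* Makes [sqrt (N q3)] equal to [N c0 / S], for the centred Gram sums, and [sqrt q3] equal to
   [sqrt N c0 / S], for a time average. *)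
pose q3 := c0 ^+ 2 * (N%:R / S ^+ 2).
have NS0 : 0 < N%:R / S ^+ 2 by apply: divr_gt0 => //; exact: exprn_gt0.
have q30 : 0 < q3 by apply: mulr_gt0 => //; exact: exprn_gt0.
have [k21 re] := kappa2sq_restricted p0 s10 kap0_gt0 a2; rewrite -/k2 in k21 re.
have k2k : kap0 <= k2 by exact: a2.
have k20 : 0 < k2 by exact: lt_le_trans k2k.
have c0k : c0 / S <= k2 / (50 * S).
  by rewrite /c0 invfM mulrA ler_pM2r ?invr_gt0// ler_pM2r ?invr_gt0.
have sqE : Num.sqrt (c0 ^+ 2 / S ^+ 2) = c0 / S.
  by rewrite -expr_div_n sqrtr_sqr ger0_norm// ltW// divr_gt0.
pose idx : finType := (('I_p + 'I_N) + ('I_p * 'I_p + 'I_N * 'I_p))%type.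
(* Scores, error sums, centred Gram sums and time averages of regressors; the last count as a single
   increment. *)
pose n_ (x : idx) : nat := match x with
  | inl (inl _) => (N * T)%N | inl (inr _) => T | inr (inl _) => N | inr (inr _) => 1%N end.
pose q_ (x : idx) : R := match x with inl _ => q1 | inr _ => q3 end.
pose Y (x : idx) (w : Om) : R := match x with
  | inl (inl l) => \sum_i \sum_t reg D i t l w * err D i t w
  | inl (inr i) => \sum_t err D i t w
  | inr (inl (l, m)) => \sum_i (gram D i l m w - Rintegral P setT (gram D i l m))
  | inr (inr (i, l)) => T%:R^-1 * \sum_t reg D i t l w end.
pose bad x := [set w | Num.sqrt ((n_ x)%:R * q_ x) <= `|Y x w|].
have areg i t l : all_moments P (reg D i t l) by case: (reg_subexp C_gt0 K_gt0 a3 i t l).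
have aerr i t : all_moments P (err D i t) by case: (err_subexp C_gt0 K_gt0 a3 i t).
have agram i l m : all_moments P (gram D i l m).
  apply: all_moments_Z; apply: all_moments_sum => t _; exact: all_moments_M.
have aY x : all_moments P (Y x).
  case: x => [[l|i]|[[l m]|[i l]]] /=.
  - by apply: all_moments_sum => i _; apply: all_moments_sum => t _; exact: all_moments_M.
  - by apply: all_moments_sum => t _.
  - apply: all_moments_sum => i _; apply: all_moments_D => //; exact: all_moments_cst.
  - by apply: all_moments_Z; apply: all_moments_sum => t _.
have Pbad x : fine (P (bad x)) <= expR 1 * expR (- (rt * q_ x `^ 3^-1)).
  apply: (concentration C_gt0 K_gt0); [|by case: x => [[]|[]]|exact: aY|].
    by case: x => [[l|i]|[lm|il]] //=; rewrite muln_gt0 N0.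
  move=> k k0; case: x => [[l|i]|[[l m]|[i l]]] /=.
  - exact: score_moments.
  - exact: err_sum_moments.
  - exact: gram_moments.
  - have sa := subexponential_average T0 (fun t => reg_subexp C_gt0 K_gt0 a3 i t l).
    apply: le_trans (subexp_m2 C_gt0 K_gt0 sa k0) _; apply: ler_pow_base.
      exact: ltW (m2_gt0 C_gt0 K_gt0 k0).
    apply: ler_peMl; first exact: ltW (m2_gt0 C_gt0 K_gt0 k0).
    by rewrite mul1r -natrD ler1n addn_gt0 muln_gt0 k0.
have mbad x : measurable (bad x) by apply: measurable_abs_ge; case: (aY x).
have mu l : measurable_fun setT (fun w => usubmx (ghat w) l 0).
  by rewrite (_ : (fun w => _) = fun w => ghat w (lshift N l) 0)//; apply/funext => w; rewrite mxE.
have md i : measurable_fun setT (fun w => dsubmx (ghat w) i 0).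
  by rewrite (_ : (fun w => _) = fun w => ghat w (rshift (L + px) i) 0)//;
    apply/funext => w; rewrite mxE.
have mle (f : Om -> R) (c : R) : measurable_fun setT f -> measurable [set w | f w <= c].
  move=> mf; rewrite -[X in measurable X]setTI.
  by apply: measurable_fun_le => //; exact: measurable_cst.
have mle3 (f1 f2 f3 : Om -> R) (c1 c2 c3' : R) : measurable_fun setT f1 ->
    measurable_fun setT f2 -> measurable_fun setT f3 ->
    measurable [set w | [/\ f1 w <= c1, f2 w <= c2 & f3 w <= c3']].
  move=> m1 m2 m3; rewrite (_ : [set w | _] =
      [set w | f1 w <= c1] `&` [set w | f2 w <= c2] `&` [set w | f3 w <= c3']).
    by apply: measurableI; [apply: measurableI|]; exact: mle.
  by apply/seteqP; split=> w /= => [[]|[[]]].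
have mnorm1 n (v : Om -> 'cV[R]_n) (u : 'cV[R]_n) :
    (forall k, measurable_fun setT (fun w => v w k 0)) ->
    measurable_fun setT (fun w => norm1 (v w - u)).
  move=> mv; apply: measurable_sum => k; apply: measurableT_comp => //.
  rewrite (_ : (fun w => _) = fun w => v w k 0 - u k 0).
    exact: measurable_funB.
  by apply/funext => w; rewrite !mxE.
have mE : measurable event.
  apply: mle3; [|exact: mnorm1..].
  apply: measurable_funM => //.
  rewrite (_ : (fun w => _) = fun w =>
    \sum_i \sum_t (\sum_l reg D i t l w * (usubmx (ghat w) l 0 - alpha l 0)
     + (dsubmx (ghat w) i 0 - eta i 0)) ^+ 2); last first.
    by apply/funext => w; exact: prediction_norm.
  apply: measurable_sum => i; apply: measurable_sum => t; apply: measurable_funX.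
  apply: measurable_funD; last exact: measurable_funB.
  apply: measurable_sum => l; apply: measurable_funM; first by case: (areg i t l).
  exact: measurable_funB.
have good w : (forall x, ~ bad x w) -> event w.
  move=> nbad.
  have {}nbad x : `|Y x w| < Num.sqrt ((n_ x)%:R * q_ x).
    by rewrite ltNge; apply/negP; exact: nbad.
  apply: (lasso_bounds N0 T0 s10 nu01 E0 lam0 k20 k21 calf mod re (opt w _)).
  - move=> l; have := nbad (inl (inl l)) => /ltW /= /le_trans; apply.
    by rewrite lamE mulrAC divff ?mul1r.
  - by move=> i; have := nbad (inl (inr i)) => /ltW /=; rewrite lamE2.
  - move=> l m; apply: le_trans c0k; have := nbad (inr (inl (l, m))) => /ltW /=.
    rewrite Psi_ZE// => [|i t]; last by apply: all_moments_integrable; exact: all_moments_M.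
    have -> : (N%:R * T%:R)^-1 * (\sum_i \sum_t reg D i t l w * reg D i t m w)
       - N%:R^-1 * \sum_i Rintegral P setT (gram D i l m)
       = N%:R^-1 * \sum_i (gram D i l m w - Rintegral P setT (gram D i l m)).
      by rewrite sumrB mulrBr invfM -mulrA mulr_sumr.
    rewrite normrM gtr0_norm ?invr_gt0// ler_pdivrMl//.
    suff -> : Num.sqrt (N%:R * q3) = N%:R * (c0 / S) by [].
    have -> : N%:R * q3 = N%:R ^+ 2 * (c0 ^+ 2 / S ^+ 2) by rewrite /q3; ring.
    by rewrite sqrtrM ?sqr_ge0// sqrtr_sqr ger0_norm// sqE.
  - move=> i l; apply: (@le_trans _ _ (c0 / S * Num.sqrt N%:R)); last first.
      by rewrite ler_pM2r.
    have := nbad (inr (inr (i, l))) => /ltW /=.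
    suff -> : Num.sqrt (1 * q3) = c0 / S * Num.sqrt N%:R by [].
    have -> : 1 * q3 = c0 ^+ 2 / S ^+ 2 * N%:R by rewrite /q3; ring.
    by rewrite sqrtrM ?divr_ge0 ?sqr_ge0// sqE.
have := union_bound P mbad mE good.
have PE : (fine (P event))%:E = P event by rewrite fineK// fin_num_measure.
rewrite -lee_fin PE; apply: le_trans; rewrite lee_fin /prob_bound.
have lgE : q1 `^ 3^-1 = M `^ 3^-1 * lg.
  rewrite /q1 powRM ?(ltW M0) ?exprn_ge0 ?(ltW lg0)//.
  by rewrite -powR_mulrn ?(ltW lg0)// -powRrM divff// powRr1// ltW.
have q3E : q3 `^ 3^-1 = c3 * (N%:R / S ^+ 2) `^ 3^-1.
  by rewrite /q3 powRM// ltW// exprn_gt0.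
set bN := expR (- B * (N%:R / S ^+ 2) `^ 3^-1).
have b3 : expR (- (rt * q3 `^ 3^-1)) <= bN.
  rewrite ler_expR mulNr lerN2 q3E mulrA; apply: ler_wpM2r => //; exact: powR_ge0.
have bp (n : nat) : (0 < n)%N -> (n <= maxn p N)%N ->
    n%:R * expR (- (rt * q1 `^ 3^-1)) <= n%:R `^ (1 - B * M `^ 3^-1).
  move=> n0 nm; rewrite lgE; apply: nat_powR_ge => //; first exact: powR_ge0.
  exact: ltW.
(* The prefactors count the events: [p] scores and [N] error sums at level [q1], [p^2] Gram entries
   and [p N] time averages at level [q3]. *)
have tot : \sum_x fine (P (bad x)) <=
    expR 1 * (p%:R * expR (- (rt * q1 `^ 3^-1))) + expR 1 * (N%:R * expR (- (rt * q1 `^ 3^-1)))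
    + expR 1 * (p%:R ^+ 2 + p%:R * N%:R) * expR (- (rt * q3 `^ 3^-1)).
  apply: le_trans (ler_sum _ (fun x _ => Pbad x)) _.
  rewrite !big_sumType /= !sumr_const !card_prod !card_ord.
  set a := expR 1 * expR (- (rt * q1 `^ _)); set b := expR 1 * expR (- (rt * q3 `^ _)).
  rewrite -[a *+ (L + px)]mulr_natl -[a *+ N]mulr_natl
    -[b *+ ((L + px) * (L + px))]mulr_natl.
  rewrite -[b *+ (N * _)]mulr_natl !natrM /a /b /p.
  by rewrite le_eqVlt; apply/orP; left; apply/eqP; ring.
have h1 := ler_wpM2l e0 (bp p p0 (leq_maxl _ _)).
have h2 := ler_wpM2l e0 (bp N N0 (leq_maxr _ _)).
have c4 : 0 <= expR 1 * (p%:R ^+ 2 + p%:R * N%:R) :> R.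
  by rewrite mulr_ge0// addr_ge0 ?sqr_ge0// mulr_ge0.
have h3 := ler_wpM2l c4 b3.
lra.
Qed.
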